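(* Fix a positive rational $s$. There exists a constant $C(s)>0$ such that for every $n$, every connected graph $G=(V,E,(r_e)_{e\in E})$ on $n$ vertices with positive edge weights, and every integer $m\ge 2$, \[ \forall\,\varepsilon\in(0,1/4):\qquad t_{\mathrm{mix}}^{\mathrm{BB}(G,s,m)}(\varepsilon)\le C(s)\,\log\!\Big(\frac{n+m}{\varepsilon}\Big)\,\max_{i,j}\mathbb E\,\hat M_{i,j}(G). \] Moreover, writing $s=b/a$ with $a,b$ coprime positive integers, one may take $C(s)=C'\,a\,(p^* )^{-2}\log\big(12a(p^* )^{-2}\big)\log(a+b)$ for a universal constant $C'>0$, where $p^*=(5/12)^{2s}/(6B(s,s))$ if $s<20$ and $p^*=\frac16\big(1-\frac{20}{s+1}\big)$ if $s\ge 20$, with $B(\cdot,\cdot)$ the beta function.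
   Context: Let $G=(V,E,(r_e)_{e\in E})$ be a finite connected graph with vertex set $V=\{1,\dots,n\}$, edge set $E$ and edge weights $r_e>0$. For $s>0$ and an integer $m\ge0$ let $\Omega_{G,m}=\{\xi\in\mathbb N_0^V:\sum_{v\in V}\xi(v)=m\}$. The $m$-particle symmetric beta-binomial splitting process $\mathrm{BB}(G,s,m)$ is the continuous-time Markov chain on $\Omega_{G,m}$ with generator $\mathcal L f=\sum_{e\in E}\frac{r_e}{\sum_{e'\in E}r_{e'}}(\mathcal P_e f-f)$, where for $e=\{v,w\}$, $\mathcal P_ef(\xi)=\mathbb E[f(\xi')]$ with $\xi'(v)=X$, $\xi'(w)=\xi(v)+\xi(w)-X$, $\xi'(u)=\xi(u)$ for $u\notin e$, and $X\sim\mathrm{BetaBin}(\xi(v)+\xi(w),s,s)$, i.e. $\mathbb P(X=k)=\binom{N}{k}\frac{B(k+s,N-k+s)}{B(s,s)}$ for $N=\xi(v)+\xi(w)$, $0\le k\le N$. For an irreducible Markov process with equilibrium $\pi$ on a finite set, $t_{\mathrm{mix}}(\varepsilon)=\inf\{t\ge0:\max_{\xi_0}\|\mathcal L(\xi_t)-\pi\|_{\mathrm{TV}}\le\varepsilon\}$, where $\|\mu-\nu\|_{\mathrm{TV}}=\sum_\omega(\mu(\omega)-\nu(\omega))_+$; $t^{\mathrm{BB}(G,s,m)}_{\mathrm{mix}}$ denotes this for $\mathrm{BB}(G,s,m)$. For distinct $i,j\in V$, $\hat M_{i,j}(G)$ is the meeting time $\inf\{t\ge0:X_t=Y_t\}$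 of two independent continuous-time random walks $X,Y$ on $V$ with $X_0=i$, $Y_0=j$, each jumping from its current vertex $v$ to $w$ at rate $r_{\{v,w\}}/(2\sum_{e\in E}r_e)$ for every edge $\{v,w\}\in E$ (i.e. each moves as the single particle of $\mathrm{BB}(G,s,1)$). The maximum is over distinct $i,j\in V$. *)

(* Defs.v *)
From HB Require Import structures.
From mathcomp Require Import all_boot all_order all_algebra.
From mathcomp Require Import all_classical all_reals all_analysis.
Set Implicit Arguments. Unset Strict Implicit. Unset Printing Implicit Defensive.
Import Order.TTheory GRing.Theory Num.Theory.
Import numFieldNormedType.Exports.
Local Open Scope ring_scope.

Section BBDefs.
Variable R : realType.

Section FinMat.
Variable S : finType.
Definition fmul (A B : S -> S -> R) : S -> S -> R :=
  fun x y => \sum_(z : S) A x z * B z y.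
Definition fid : S -> S -> R := fun x y => (x == y)%:R.
Definition fpow (A : S -> S -> R) (k : nat) : S -> S -> R :=
  iter k (fun B => fmul B A) fid.
Definition fexp (t : R) (A : S -> S -> R) : S -> S -> R :=
  fun x y => limn (fun N => \sum_(k < N) (t ^+ k / (k`!)%:R) * fpow A k x y).

Definition tv (mu nu : S -> R) : R := \sum_(x : S) Num.max (mu x - nu x) 0.

Definition equilibrium (L : S -> S -> R) (pi : S -> R) : Prop :=
  (forall x, 0 <= pi x) /\ \sum_(x : S) pi x = 1 /\
  (forall t : R, 0 <= t -> forall y, \sum_(x : S) pi x * fexp t L x y = pi y).

(** t_mix(eps) = inf { t >= 0 : max_{x0} || law(X_t | X_0 = x0) - pi ||_TV <= eps },
    as an extended real (+oo if the set is empty). *)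
Definition tmix (L : S -> S -> R) (pi : S -> R) (eps : R) : \bar R :=
  ereal_inf [set t%:E | t in
    [set t : R | 0 <= t /\ \big[Num.max/0]_(x0 : S) tv (fexp t L x0) pi <= eps]].
End FinMat.

Definition betaR (x y : R) : R :=
  fine (\int[lebesgue_measure]_(t in `]0%R, 1%R[%classic)
          ((t `^ (x - 1)) * ((1 - t) `^ (y - 1)))%:E)%E.

Definition betabin (s : R) (N k : nat) : R :=
  'C(N, k)%:R * betaR (k%:R + s) ((N - k)%:R + s) / betaR s s.

(** Weighted graphs on V = 'I_n : symmetric nonnegative weights, no loops;
    the edge set is E = { {v,w} : r v w > 0 }, connectivity of (V,E). *)
Definition connected_wgraph (n : nat) (r : 'I_n -> 'I_n -> R) : Prop :=
  (forall v, r v v = 0) /\ (forall v w, r v w = r w v) /\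
  (forall v w, 0 <= r v w) /\
  (forall v w, connect [rel x y | 0 < r x y] v w).

Definition totw (n : nat) (r : 'I_n -> 'I_n -> R) : R :=
  \sum_(v : 'I_n) \sum_(w : 'I_n | (v < w)%N) r v w.

Definition Omega (n m : nat) :=
  {f : {ffun 'I_n -> 'I_m.+1} | \sum_(i < n) (f i : nat) == m}.

Definition occ (n m : nat) (xi : Omega n m) (v : 'I_n) : nat := val xi v.

Definition Pedge (s : R) (n m : nat) (v w : 'I_n) (xi eta : Omega n m) : R :=
  let N := (occ xi v + occ xi w)%N in
  \sum_(k < N.+1) betabin s N k *
    ([forall u, (u != v) && (u != w) ==> (occ eta u == occ xi u)]
     && (occ eta v == k) && (occ eta w == N - k)%N)%:R.

Definition BBgen (s : R) (n m : nat) (r : 'I_n -> 'I_n -> R) :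
    Omega n m -> Omega n m -> R :=
  fun xi eta => \sum_(v : 'I_n) \sum_(w : 'I_n | (v < w)%N)
     (r v w / totw r) * (Pedge s v w xi eta - (xi == eta)%:R).

Definition rw_gen (n : nat) (r : 'I_n -> 'I_n -> R) : 'I_n -> 'I_n -> R :=
  fun v w => if v == w then - (\sum_(u : 'I_n | u != v) r v u) / (2 * totw r)
             else r v w / (2 * totw r).

Definition pair_gen (n : nat) (r : 'I_n -> 'I_n -> R) :
    ('I_n * 'I_n)%type -> ('I_n * 'I_n)%type -> R :=
  fun p q => rw_gen r p.1 q.1 * (p.2 == q.2)%:R + (p.1 == q.1)%:R * rw_gen r p.2 q.2.

Definition killed_gen (n : nat) (r : 'I_n -> 'I_n -> R) :
    ('I_n * 'I_n)%type -> ('I_n * 'I_n)%type -> R :=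
  fun p q => if (p.1 != p.2) && (q.1 != q.2) then pair_gen r p q else 0.

(** P(M_{i,j} > t) = P_{(i,j)}(pair process has not hit the diagonal by time t) *)
Definition meet_surv (n : nat) (r : 'I_n -> 'I_n -> R) (i j : 'I_n) (t : R) : R :=
  \sum_(q : 'I_n * 'I_n | q.1 != q.2) fexp t (killed_gen r) (i, j) q.

(** E[M_{i,j}] = int_0^oo P(M_{i,j} > t) dt *)
Definition exp_meet (n : nat) (r : 'I_n -> 'I_n -> R) (i j : 'I_n) : \bar R :=
  (\int[lebesgue_measure]_(t in `[0%R, +oo[%classic) (meet_surv r i j t)%:E)%E.

Definition max_meet (n : nat) (r : 'I_n -> 'I_n -> R) : \bar R :=
  \big[Order.max/0%E]_(i : 'I_n) \big[Order.max/0%E]_(j : 'I_n | i != j) exp_meet r i j.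

Definition mixing_bound (s C : R) : Prop :=
  forall (n : nat) (r : 'I_n -> 'I_n -> R) (m : nat),
    (1 < n)%N -> connected_wgraph r -> (2 <= m)%N ->
    forall pi : Omega n m -> R, equilibrium (BBgen s r) pi ->
    forall eps : R, 0 < eps < 1/4 ->
      (tmix (BBgen s r) pi eps <= (C * ln ((n + m)%:R / eps))%:E * max_meet r)%E.

Definition pstar (s : R) : R :=
  if s < 20 then ((5/12) `^ (2 * s)) / (6 * betaR s s)
  else (1 - 20 / (s + 1)) / 6.

End BBDefs.

(* Main.v *)
(** Path coupling. If [X] is BetaBin([N], [s], [s]) then, by the Polya urn scheme,
    adding one particle to [X] or to [N - X] with probability proportional to
    [X + s] and [N - X + s] gives BetaBin([N + 1], [s], [s]), and by symmetry the
    added particle goes to either side with probability 1/2. Hence two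
    configurations that differ by the position of a single particle, at [i] and
    at [j], can be updated along the same edges so that they still differ by a
    single particle, whose two positions move as independent walks until the edge
    between them rings; at that moment the configurations merge. This is exactly
    the meeting of two independent walks, so the distance to equilibrium at time
    [t] is at most [m * max P(M_ij > t)]. By Markov's inequality the survival
    probability is at most 1/2 at time [2 max E M], and it is submultiplicative.
    The resulting constant does not depend on [s].

    The coupling is never built as a process: it appears as a one-step inequality
    for the kernels [I + generator], which passes to the semigroups by
    [exp (t (Q - I)) = exp (- t) exp (t Q)]. *)

Require Import Defs.
From HB Require Import structures.
From mathcomp Require Import all_boot all_order all_algebra.
From mathcomp Require Import all_classical all_reals all_analysis measurable_realfun.
From mathcomp Require Import ring lra.
Set Implicit Arguments. Unset Strict Implicit. Unset Printing Implicit Defensive.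
Import Order.TTheory GRing.Theory Num.Theory.
Import numFieldNormedType.Exports.
Local Open Scope classical_set_scope.
Local Open Scope ring_scope.

(** * The beta function *)

Section Beta.
Variable R : realType.
Implicit Types (x y s t e : R).
Local Notation mu := (@lebesgue_measure R).

Definition betaf x y t : R := t `^ (x - 1) * (1 - t) `^ (y - 1).

Lemma betaf_ge0 x y t : 0 <= betaf x y t.
Proof. by rewrite mulr_ge0 ?powR_ge0. Qed.

Lemma betaf_sym x y t : betaf x y (1 - t) = betaf y x t.
Proof. by rewrite /betaf opprB addrCA subrr addr0 mulrC. Qed.

(** The factor 1 = t + (1 - t) is inserted into the integrand. *)
Lemma betaf_rec x y t : 0 < t < 1 ->
  betaf x y t = betaf (x + 1) y t + betaf x (y + 1) t.
Proof.
move=> /andP[t0 t1]; have u0 : 0 < 1 - t by rewrite subr_gt0.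
have pS (z w : R) : 0 < z -> z `^ (w + 1 - 1) = z * z `^ (w - 1).
  move=> z0; rewrite mulrC -[X in _ * X](powRr1 (ltW z0)).
  by rewrite -powRD ?(gt_eqF z0) ?implybT// addrAC.
by rewrite /betaf !pS//; ring.
Qed.

Lemma measurable_betaf (D : set R) x y : measurable_fun D (betaf x y).
Proof.
apply: (@measurable_funS _ _ _ _ setT) => //.
apply: measurable_funM; first exact: measurable_powR.
apply: (@measurableT_comp _ _ _ _ _ _ (@powR R ^~ (y - 1))) => //.
exact: measurable_funB.
Qed.

Lemma is_derive_powR_onem y t : t < 1 ->
  is_derive t 1 (fun t => (1 - t) `^ y) (- (y * (1 - t) `^ (y - 1))).
Proof.
move=> t1; have u0 : 0 < 1 - t by rewrite subr_gt0.
have d1 : is_derive t 1 (fun t : R => 1 - t) (-1).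
  by rewrite -[-1]add0r; apply: is_deriveB.
have := @is_derive1_comp R (@powR R ^~ y) (fun t : R => 1 - t) t _ _
  (is_derive1_powR y u0) d1.
by rewrite mulrN1.
Qed.

Lemma derivable_betaf x y t : 0 < t < 1 -> derivable (betaf x y) t 1.
Proof.
move=> /andP[t0 t1]; apply: derivableM.
  by apply: derivable_powR; rewrite in_itv /= t0.
by case: (is_derive_powR_onem (y - 1) t1).
Qed.

Lemma continuous_betaf x y a b : 0 < a -> b < 1 ->
  {within `[a, b], continuous (betaf x y)}.
Proof.
move=> a0 b1; apply: derivable_within_continuous => t.
rewrite in_itv/= => /andP[at_ tb]; apply: derivable_betaf.
by rewrite (lt_le_trans a0)// (le_lt_trans tb).
Qed.

(** Substitution t -> 1 - t. For exponents below 1 the integrand blows up at an endpoint, so the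
    work is done on a compact subinterval, where it is continuous. *)
Lemma beta_trunc_sym x y e : 0 < e -> e < 1 / 2 ->
  (\int[mu]_(t in `[e%R, (1 - e)%R]) (betaf x y t)%:E =
   \int[mu]_(t in `[e%R, (1 - e)%R]) (betaf y x t)%:E)%E.
Proof.
move=> e0 e2.
pose F (r : R) : R := 1 - r.
have dF : F^`()%classic = cst (-1).
  apply/funext => u; rewrite derive1E.
  have : is_derive u 1 F (0 - 1) by apply: is_deriveB.
  by move=> [_ ->]; rewrite sub0r.
have := @integration_by_substitution_decreasing R F (betaf x y) e (1 - e).
have FE : F (1 - e) = e by rewrite /F opprB addrCA subrr addr0.
rewrite dF FE => -> //.
- by apply: eq_integral => t _; rewrite !fctE opprK mulr1 /= betaf_sym.
- by lra.
- by move=> u v _ _ uv; rewrite /F; lra.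
- by move=> ? ?; exact: cvg_cst.
- exact: is_cvg_cst.
- exact: is_cvg_cst.
- split => /=.
  + by move=> u _; exact: derivableB.
  + by apply: cvg_at_right_filter; apply: cvgB => //; exact: cvg_cst.
  + by apply: cvg_at_left_filter; apply: cvgB => //; exact: cvg_cst.
- by apply: continuous_betaf => //; rewrite /F; lra.
Qed.

(** The power is t^y / t, with t^y at most 1 and 1/t at most 2. *)
Lemma powR_half_le2 y t : 0 < y -> 1 / 2 <= t -> t <= 1 -> t `^ (y - 1) <= 2.
Proof.
move=> y0 t2 t1; have t0 : 0 < t by lra.
rewrite powRB ?(gt_eqF t0) ?implybT// (powRr1 (ltW t0)).
rewrite ler_pdivrMr//; apply: (@le_trans _ _ 1); last by lra.
by rewrite -(powRr0 t) ger_powR ?t0// ltW.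
Qed.

(** On each half of the interval, the factor that is regular there is at most 2. *)
Lemma betaf_le x y t : 0 < x -> 0 < y -> 0 < t < 1 ->
  betaf x y t <= 2 * t `^ (x - 1) + 2 * (1 - t) `^ (y - 1).
Proof.
move=> x0 y0 /andP[t0 t1]; rewrite /betaf.
have tp : 0 <= t `^ (x - 1) by exact: powR_ge0.
have up : 0 <= (1 - t) `^ (y - 1) by exact: powR_ge0.
have [t2|t2] := leP t (1 / 2).
  have : (1 - t) `^ (y - 1) <= 2 by apply: powR_half_le2 => //; lra.
  by nra.
have : t `^ (x - 1) <= 2 by apply: powR_half_le2 => //; lra.
by nra.
Qed.

(** The majorant of [betaf_le] has the explicit primitive [G]. The bound is uniform in [e], hence it
    survives the limit and makes the beta integral finite. *)
Lemma beta_trunc_le x y e : 0 < x -> 0 < y -> 0 < e -> e < 1 / 2 ->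
  (\int[mu]_(t in `[e%R, (1 - e)%R]) (betaf x y t)%:E <= (2 / x + 2 / y)%:E)%E.
Proof.
move=> x0 y0 e0 e2.
pose g t : R := 2 * t `^ (x - 1) + 2 * (1 - t) `^ (y - 1).
pose G t : R := 2 / x * t `^ x - 2 / y * (1 - t) `^ y.
have dG t : 0 < t < 1 -> is_derive t 1 G (g t).
  move=> /andP[t0 t1].
  have h1 := is_derive1_powR x t0; have h2 := is_derive_powR_onem y t1.
  have -> : g t = (2 / x) *: (x * t `^ (x - 1))
      - (2 / y) *: (- (y * (1 - t) `^ (y - 1))).
    rewrite /g /GRing.scale /=; field.
    by rewrite !gt_eqF.
  apply: is_deriveB; exact: is_deriveZ.
have inI t : t \in `[e, 1 - e] -> 0 < t < 1.
  by rewrite in_itv/= => /andP[? ?]; lra.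
have cg : {within `[e, 1 - e], continuous g}.
  apply: derivable_within_continuous => t /inI /andP[t0 t1].
  apply: derivableD; apply: derivableM => //.
    by apply: derivable_powR; rewrite in_itv /= t0.
  by case: (is_derive_powR_onem (y - 1) t1).
have mg (D : set R) : measurable_fun D g.
  apply: (@measurable_funS _ _ _ _ setT) => //.
  apply: measurable_funD; apply: measurable_funM => //.
  apply: (@measurableT_comp _ _ _ _ _ _ (@powR R ^~ (y - 1))) => //.
  exact: measurable_funB.
apply: (@le_trans _ _ (\int[mu]_(t in `[e%R, (1 - e)%R]) (g t)%:E)%E).
  apply: ge0_le_integral => //=.
  - by move=> t _; rewrite lee_fin betaf_ge0.
  - by apply/measurable_EFinP; exact: measurable_betaf.
  - by apply/measurable_EFinP; exact: mg.
  - move=> t tI; rewrite lee_fin; apply: betaf_le => //; exact: inI.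
rewrite (@continuous_FTC2 R g G) //.
- rewrite -EFinB lee_fin /G.
  have le1 (z u : R) : 0 < z -> 0 < u < 1 -> u `^ z <= 1.
    by move=> z0 /andP[u0 u1]; rewrite -(powRr0 u) ger_powR ?u0 ?ltW.
  have := le1 x (1 - e) x0; have := le1 y (1 - e) y0.
  have e01 : 0 < 1 - e < 1 by lra.
  move=> /(_ e01) h1 /(_ e01) h2.
  have := powR_ge0 e x; have := powR_ge0 (1 - (1 - e)) y.
  have ix : 0 < 2 / x by rewrite divr_gt0.
  have iy : 0 < 2 / y by rewrite divr_gt0.
  by move=> h3 h4; nra.
- by lra.
- split.
  + move=> t; rewrite in_itv/= => /andP[te t1].
    by case: (dG t) => //; lra.
  + apply: cvg_at_right_filter; apply: differentiable_continuous.
    by apply/derivable1_diffP; case: (dG e) => //; lra.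
  + apply: cvg_at_left_filter; apply: differentiable_continuous.
    by apply/derivable1_diffP; case: (dG (1 - e)) => //; lra.
- move=> t; rewrite in_itv/= => /andP[te t1].
  have /dG ? : 0 < t < 1 by lra.
  by rewrite derive1E derive_val.
Qed.

(** The shift by 3 keeps the left endpoint below 1/2 already at [n = 0]. *)
Definition beta_itv (n : nat) : set R := `[n.+3%:R^-1, 1 - n.+3%:R^-1]%classic.

Lemma beta_itv_bounds (n : nat) : 0 < n.+3%:R^-1 :> R /\ n.+3%:R^-1 < 1 / 2 :> R.
Proof.
split; first by rewrite invr_gt0.
by rewrite div1r ltf_pV2 ?posrE// ltr_nat.
Qed.

(** Monotone convergence along compact intervals that exhaust ]0, 1[. *)
Lemma beta_trunc_cvg x y :
  ((fun n => \int[mu]_(t in beta_itv n) (betaf x y t)%:E) @ \oo -->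
   \int[mu]_(t in `]0%R, 1%R[) (betaf x y t)%:E)%E.
Proof.
have -> : `]0%R, 1%R[%classic = \bigcup_n beta_itv n.
  apply/seteqP; split => t /=.
    rewrite in_itv/= => /andP[t0 t1].
    have m0 : 0 < Num.min t (1 - t) by rewrite lt_min t0 subr_gt0.
    have [k hk] := ltr_add_invr m0.
    exists k => //=; rewrite /beta_itv /= in_itv/=.
    have h : k.+3%:R^-1 <= k.+1%:R^-1 :> R.
      by rewrite lef_pV2 ?posrE// ler_nat leqW.
    move: hk; rewrite add0r lt_min => /andP[h1 h2].
    rewrite (le_trans h (ltW h1)) /= lerBrDl -lerBrDr.
    exact: le_trans h (ltW h2).
  move=> [k _]; rewrite /beta_itv /= !in_itv/= => /andP[h1 h2].
  have [e0 e2] := beta_itv_bounds k.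
  by rewrite (lt_le_trans e0 h1)/= (le_lt_trans h2)// ltrBlDr ltrDl.
apply: ge0_nondecreasing_set_cvg_integral.
- apply/nondecreasing_seqP => n; apply/subsetPset => t.
  rewrite /beta_itv /= !in_itv/= => /andP[h1 h2].
  have h : n.+4%:R^-1 <= n.+3%:R^-1 :> R.
    by rewrite lef_pV2 ?posrE// ler_nat.
  by rewrite (le_trans h h1) (le_trans h2)// lerD2l lerN2.
- by move=> n; exact: measurable_itv.
- by move=> n; apply/measurable_EFinP; exact: measurable_betaf.
- by move=> n t _; rewrite lee_fin betaf_ge0.
Qed.

Lemma beta_trunc_lim x y :
  limn (fun n => \int[mu]_(t in beta_itv n) (betaf x y t)%:E)%E =
  (\int[mu]_(t in `]0%R, 1%R[) (betaf x y t)%:E)%E.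
Proof. by apply: cvg_lim => //; exact: beta_trunc_cvg. Qed.

Lemma beta_integral_sym x y :
  (\int[mu]_(t in `]0%R, 1%R[) (betaf x y t)%:E =
   \int[mu]_(t in `]0%R, 1%R[) (betaf y x t)%:E)%E.
Proof.
rewrite -(beta_trunc_lim x y) -(beta_trunc_lim y x).
by congr (limn _); apply/funext => n; have [e0 e2] := beta_itv_bounds n; exact: beta_trunc_sym.
Qed.

Lemma beta_integral_le x y : 0 < x -> 0 < y ->
  (\int[mu]_(t in `]0%R, 1%R[) (betaf x y t)%:E <= (2 / x + 2 / y)%:E)%E.
Proof.
move=> x0 y0; rewrite -beta_trunc_lim.
apply: lime_le; first by apply/cvg_ex; eexists; exact: beta_trunc_cvg.
apply: nearW => n; have [e0 e2] := beta_itv_bounds n; exact: beta_trunc_le.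
Qed.

Lemma beta_integral_fin x y : 0 < x -> 0 < y ->
  (\int[mu]_(t in `]0%R, 1%R[) (betaf x y t)%:E \is a fin_num)%E.
Proof.
move=> x0 y0; rewrite ge0_fin_numE.
  by apply: le_lt_trans (beta_integral_le x0 y0) _; rewrite ltry.
by apply: integral_ge0 => t _; rewrite lee_fin betaf_ge0.
Qed.

Lemma betaRE x y : betaR x y = fine (\int[mu]_(t in `]0%R, 1%R[) (betaf x y t)%:E)%E.
Proof. by []. Qed.

Lemma betaR_sym x y : betaR x y = betaR y x.
Proof. by rewrite !betaRE beta_integral_sym. Qed.

(** Integrates [betaf_rec]. Finiteness of the integrals enters because [fine] is additive only on
    finite values. *)
Lemma betaR_rec x y : 0 < x -> 0 < y ->
  betaR x y = betaR (x + 1) y + betaR x (y + 1).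
Proof.
move=> x0 y0; have x1 : 0 < x + 1 by rewrite addr_gt0.
have y1 : 0 < y + 1 by rewrite addr_gt0.
rewrite !betaRE -fineD ?beta_integral_fin//; congr fine.
rewrite -ge0_integralD//=.
- apply: eq_integral => t; rewrite inE/= in_itv/= => t01.
  by rewrite (betaf_rec x y t01).
- by move=> t _; rewrite lee_fin betaf_ge0.
- by apply/measurable_EFinP; exact: measurable_betaf.
- by move=> t _; rewrite lee_fin betaf_ge0.
- by apply/measurable_EFinP; exact: measurable_betaf.
Qed.

(** The integral is restricted to [5/12, 7/12], of length 1/6, where t and 1 - t are both at least
    5/12. *)
Lemma betaR_ge x y : 0 < x -> 0 < y -> (5 / 12) `^ (x + y) / 6 <= betaR x y.
Proof.
move=> x0 y0; rewrite betaRE -lee_fin fineK ?beta_integral_fin//.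
pose J : set R := `[5 / 12, 7 / 12]%classic.
have mJ : measurable J by exact: measurable_itv.
have cE : (((5 / 12) `^ (x + y) / 6)%:E =
    \int[mu]_(t in J) (cst ((5 / 12) `^ (x + y))%:E) t)%E.
  rewrite integral_cst//.
  rewrite /J [X in (_ * X)%E]lebesgue_measure_itv /= lte_fin ifT; last by lra.
  by rewrite -EFinB -EFinM; congr (_%:E); congr (_ * _); lra.
rewrite cE; apply: (@le_trans _ _ (\int[mu]_(t in J) (betaf x y t)%:E)%E).
  apply: ge0_le_integral => //=.
  - by apply/measurable_EFinP; exact: measurable_betaf.
  - move=> t; rewrite /J /= in_itv/= => /andP[h1 h2]; rewrite lee_fin /betaf.
    (* For a base below 1, lowering the exponent from z to z - 1 increases the power. *)
    have aux (z u : R) : 0 < z -> 5 / 12 <= u -> u < 1 ->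
        (5 / 12) `^ z <= u `^ (z - 1).
      move=> z0 u0 u1; apply: (@le_trans _ _ (u `^ z)).
        by apply: ge0_ler_powR => //; rewrite ?nnegrE ?ltW//; lra.
      by apply: ger_powR; lra.
    rewrite powRD; last by apply/implyP => _; apply/eqP; lra.
    by rewrite ler_pM ?powR_ge0//; apply: aux => //; lra.
apply: ge0_subset_integral => //=.
- by apply/measurable_EFinP; exact: measurable_betaf.
- by move=> t _; rewrite lee_fin betaf_ge0.
- by move=> t; rewrite /J /= !in_itv/= => /andP[h1 h2]; lra.
Qed.

Lemma betaR_gt0 x y : 0 < x -> 0 < y -> 0 < betaR x y.
Proof.
move=> x0 y0; apply: lt_le_trans (betaR_ge x0 y0).
by rewrite divr_gt0// powR_gt0//; lra.
Qed.

(** Serves to bound the factor [p ^- 2] of the stated constant below by 1. For s < 20 the upper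
    bound is [betaR_ge] at x = y = s. *)
Lemma pstar_gt0_le1 s : 0 < s -> 0 < pstar s <= 1.
Proof.
move=> s0; rewrite /pstar; case: (ltP s 20) => s20.
  have b0 := betaR_gt0 s0 s0; have := betaR_ge s0 s0.
  rewrite (_ : s + s = 2 * s); last by ring.
  rewrite ler_pdivrMr// => h.
  have p0 : 0 < (5 / 12 : R) `^ (2 * s) by rewrite powR_gt0//; lra.
  rewrite divr_gt0 ?mulr_gt0//=.
  by rewrite ler_pdivrMr ?mulr_gt0// mul1r [6 * _]mulrC.
have h : 20 / (s + 1) < 1 by rewrite ltr_pdivrMr; lra.
have h' : 0 <= 20 / (s + 1) by rewrite divr_ge0; lra.
by apply/andP; split; lra.
Qed.

End Beta.

(** * Exponentials of finite matrices *)

Section CauchyProduct.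
Variable R : realType.
Implicit Types x y : nat -> R.

Definition psum x n : R := \sum_(k < n) x k.
Definition cprod x y n : R := \sum_(k < n.+1) x k * y (n - k)%N.
Definition abs_summable x := cvgn (psum (fun k => `|x k|)).

Lemma psum_series x : psum x = series x.
Proof. by apply/funext => n; rewrite /psum /series /= big_mkord. Qed.

Lemma psumS x n : psum x n.+1 = psum x n + x n.
Proof. by rewrite /psum big_ord_recr. Qed.

Lemma abs_summable_cvg x : abs_summable x -> cvgn (psum x).
Proof.
rewrite /abs_summable !psum_series => h.
exact: (@normed_cvg R R).
Qed.

Lemma psum_cprod x y n :
  psum (cprod x y) n = \sum_(i < n) x i * psum y (n - i).
Proof.
elim: n => [|n IH]; first by rewrite /psum !big_ord0.
rewrite psumS IH /cprod.
rewrite [RHS](eq_bigr (fun i : 'I_n.+1 =>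
  x i * psum y (n - i)%N + x i * y (n - i)%N)); last first.
  by move=> i _; rewrite subSn ?psumS ?mulrDr// -ltnS.
by rewrite big_split /= [in RHS]big_ord_recr /= subnn {3}/psum big_ord0 mulr0 addr0.
Qed.

Lemma psum_ge0 x n : (forall k, 0 <= x k) -> 0 <= psum x n.
Proof. by move=> x0; apply: sumr_ge0. Qed.

Lemma psum_le x m n : (forall k, 0 <= x k) -> (m <= n)%N ->
  psum x m <= psum x n.
Proof.
move=> x0 mn; rewrite -(subnKC mn); elim: (n - m)%N => [|k IH].
  by rewrite addn0.
by rewrite addnS psumS (le_trans IH)// lerDl.
Qed.

(** The square of side n/2 lies inside the triangle of index pairs with sum below n. *)
Lemma psum_cprod_ge x y n : (forall k, 0 <= x k) -> (forall k, 0 <= y k) ->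
  psum x n./2 * psum y n./2 <= psum (cprod x y) n.
Proof.
move=> x0 y0; rewrite psum_cprod.
have hn : (n./2 <= n)%N by rewrite -[leqRHS]odd_double_half -addnn addnA leq_addl.
rewrite -(subnKC hn) big_split_ord /= {1}/psum mulr_suml.
rewrite subnKC//; apply: ler_wpDr.
  by apply: sumr_ge0 => i _; rewrite mulr_ge0// psum_ge0.
apply: ler_sum => i _; rewrite ler_wpM2l//; apply: psum_le => //.
rewrite leq_subRL; last by rewrite (leq_trans _ hn)// ltnW.
apply: (@leq_trans (n./2 + n./2)%N); first by rewrite leq_add2r ltnW.
by rewrite addnn -geq_half_double.
Qed.

(** The difference collects the terms of the square of side n outside the triangle. In absolute
    value they are at most the square of side n minus the triangle for the series of absolute
    values, and that triangle contains the square of side n/2. *)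
Lemma psum_cprod_dist x y n :
  `|psum x n * psum y n - psum (cprod x y) n| <=
  psum (fun k => `|x k|) n * psum (fun k => `|y k|) n
  - psum (fun k => `|x k|) n./2 * psum (fun k => `|y k|) n./2.
Proof.
apply: (@le_trans _ _ (psum (fun k => `|x k|) n * psum (fun k => `|y k|) n
  - psum (cprod (fun k => `|x k|) (fun k => `|y k|)) n)); last first.
  by rewrite lerD2l lerN2 psum_cprod_ge.
rewrite !psum_cprod {1 3}/psum !mulr_suml -!sumrB.
apply: (le_trans (ler_norm_sum _ _ _)); apply: ler_sum => i _.
rewrite -!mulrBr normrM ler_wpM2l//.
have := leq_subr i n; move: (n - i)%N => m mn.
rewrite -(subnKC mn); elim: (n - m)%N => [|k IH].
  by rewrite addn0 !subrr normr0.
rewrite addnS !psumS !(addrAC _ _ (- _)).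
by apply: (le_trans (ler_normD _ _)); rewrite lerD2r.
Qed.

Lemma cvg_half : (fun n => n./2) @ \oo --> \oo.
Proof.
move=> A [N _ NA]; exists N.*2 => // n /= Nn; apply: NA => /=.
by rewrite geq_half_double.
Qed.

(** The bound of [psum_cprod_dist] is a difference of two sequences with the same limit. *)
Lemma cvg_psum_cprod x y : abs_summable x -> abs_summable y ->
  psum (cprod x y) @ \oo --> limn (psum x) * limn (psum y).
Proof.
move=> ax ay.
set X := psum (fun k => `|x k|); set Y := psum (fun k => `|y k|).
have cXY : (fun n => X n * Y n) @ \oo --> limn X * limn Y by exact: cvgM.
have c0 : (fun n => X n * Y n - X n./2 * Y n./2) @ \oo --> (0 : R).
  rewrite -(subrr (limn X * limn Y)); apply: cvgB => //.
  exact: (cvg_comp _ _ cvg_half cXY).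
have cd : (fun n => psum x n * psum y n - psum (cprod x y) n) @ \oo --> (0 : R).
  apply: norm_cvg0; apply: (@squeeze_cvgr _ _ _ _ (fun=> 0) _ _ _ _ (cvg_cst _) c0).
  by apply: nearW => n; rewrite normr_ge0 psum_cprod_dist.
have cxy : (fun n => psum x n * psum y n) @ \oo --> limn (psum x) * limn (psum y).
  by apply: cvgM; exact: abs_summable_cvg.
rewrite (_ : psum (cprod x y) = (fun n => psum x n * psum y n
    - (psum x n * psum y n - psum (cprod x y) n))); last first.
  by apply/funext => n; rewrite opprB addrCA subrr addr0.
by rewrite -[X in _ --> X]subr0; exact: cvgB.
Qed.

Lemma cvg_fsum (I : Type) (r : seq I) (u : I -> nat -> R) (l : I -> R) :
  (forall i, u i @ \oo --> l i) ->
  (fun n => \sum_(i <- r) u i n) @ \oo --> \sum_(i <- r) l i.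
Proof.
move=> h; elim: r => [|i r IH].
  rewrite big_nil (_ : (fun n => _) = fun=> 0); first exact: cvg_cst.
  by apply/funext => n; rewrite big_nil.
rewrite big_cons (_ : (fun n => _) = fun n => u i n + \sum_(j <- r) u j n).
  exact: cvgD.
by apply/funext => n; rewrite big_cons.
Qed.

End CauchyProduct.

(** * The exponential series of a finite matrix *)

Section FinExp.
Variables (R : realType) (S : finType).
Implicit Types (A B : S -> S -> R) (t u : R) (x y z : S) (f : S -> R).

Local Arguments fpow : simpl never.

Definition ecoef t A x y (k : nat) : R := t ^+ k / k`!%:R * fpow A k x y.

Lemma fpow0 A x y : fpow A 0 x y = (x == y)%:R.
Proof. by []. Qed.

Lemma fpowS A k x y : fpow A k.+1 x y = \sum_z fpow A k x z * A z y.
Proof. by []. Qed.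

Lemma fpow_add A k l x y :
  fpow A (k + l) x y = \sum_z fpow A k x z * fpow A l z y.
Proof.
elim: l x y => [|l IH] x y.
  rewrite addn0 (bigD1 y)//= fpow0 eqxx mulr1 big1 ?addr0// => z /negbTE zy.
  by rewrite fpow0 zy mulr0.
rewrite addnS fpowS; under eq_bigr do rewrite IH mulr_suml.
rewrite exchange_big /=; apply: eq_bigr => z _; rewrite fpowS mulr_sumr.
by apply: eq_bigr => w _; rewrite mulrA.
Qed.

Lemma fpow1 A x y : fpow A 1 x y = A x y.
Proof.
rewrite fpowS (bigD1 x)//= fpow0 eqxx mul1r big1 ?addr0// => z zx.
by rewrite fpow0 eq_sym (negbTE zx) mul0r.
Qed.

(** The sum of all absolute entries dominates every row sum; this crude norm suffices for absolute
    convergence of the series. *)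
Lemma fpow_norm_le A k x :
  \sum_y `|fpow A k x y| <= (\sum_x \sum_y `|A x y|) ^+ k.
Proof.
set M := \sum_x _; elim: k => [|k IH].
  rewrite expr0 (bigD1 x)//= fpow0 eqxx normr1 big1 ?addr0// => y yx.
  by rewrite fpow0 eq_sym (negbTE yx) normr0.
apply: (@le_trans _ _ (\sum_y \sum_z `|fpow A k x z| * `|A z y|)).
  apply: ler_sum => y _; rewrite fpowS (le_trans (ler_norm_sum _ _ _))//.
  by apply: ler_sum => z _; rewrite normrM.
rewrite exchange_big /= exprSr; apply: le_trans (ler_wpM2r _ IH); last first.
  by apply: sumr_ge0 => ? _; apply: sumr_ge0.
rewrite mulr_suml; apply: ler_sum => z _; rewrite -mulr_sumr ler_wpM2l//.
rewrite [leRHS](bigD1 z)//= lerDl; apply: sumr_ge0 => ? _; exact: sumr_ge0.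
Qed.

Lemma ecoef_abs_summable t A x y : abs_summable (ecoef t A x y).
Proof.
rewrite /abs_summable psum_series.
pose M : R := \sum_x \sum_y `|A x y|.
have M0 : 0 <= M by apply: sumr_ge0 => ? _; exact: sumr_ge0.
apply: (@series_le_cvg _ _ (exp_coeff (`|t| * M))) => //.
- by move=> k; apply: exp_coeff_ge0; rewrite mulr_ge0.
- move=> k; rewrite /ecoef /exp_coeff /= normrM normf_div normrX normr_nat.
  rewrite exprMn [leRHS]mulrAC; apply: ler_wpM2l.
    by rewrite divr_ge0// exprn_ge0.
  apply: le_trans (fpow_norm_le A k x).
  by rewrite (bigD1 y)//= lerDl; exact: sumr_ge0.
- exact: is_cvg_series_exp_coeff.
Qed.

Lemma fexpE t A x y : fexp t A x y = limn (psum (ecoef t A x y)).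
Proof. by []. Qed.

Lemma fexp_cvg t A x y : psum (ecoef t A x y) @ \oo --> fexp t A x y.
Proof. rewrite fexpE; exact: (abs_summable_cvg (@ecoef_abs_summable t A x y)). Qed.

Lemma fact_neq0 (n : nat) : n`!%:R != 0 :> R.
Proof. by rewrite pnatr_eq0 -lt0n fact_gt0. Qed.

Lemma bin_factr (n k : nat) : (k <= n)%N ->
  'C(n, k)%:R / n`!%:R = (k`!%:R)^-1 * ((n - k)`!%:R)^-1 :> R.
Proof.
move=> kn; have := bin_fact kn => /(congr1 (fun n => n%:R : R)).
rewrite !natrM => <-; have hC : 'C(n, k)%:R != 0 :> R.
  by rewrite pnatr_eq0 -lt0n bin_gt0.
by field; rewrite hC !fact_neq0.
Qed.

(** Cauchy product of the two series, summed over the intermediate state; the binomial theorem for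
    (t + u)^N identifies the coefficients. *)
Lemma fexpD t u A x y :
  fexp (t + u) A x y = \sum_z fexp t A x z * fexp u A z y.
Proof.
have h : (fun n => \sum_z psum (cprod (ecoef t A x z) (ecoef u A z y)) n) @ \oo
    --> \sum_z fexp t A x z * fexp u A z y.
  apply: cvg_fsum => z; apply: cvg_psum_cprod; exact: ecoef_abs_summable.
rewrite fexpE -(cvg_lim _ h)//; congr (limn _); apply/funext => n.
rewrite /psum exchange_big /=; apply: eq_bigr => N _.
rewrite /cprod exchange_big /= /ecoef addrC exprDn !mulr_suml.
apply: eq_bigr => k _; have kN : (k <= N)%N by rewrite -ltnS.
rewrite (_ : fpow A N = fpow A (k + (N - k))%N); last by rewrite subnKC.
rewrite fpow_add mulr_sumr; apply: eq_bigr => z _.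
rewrite -[_ *+ 'C(N, k)]mulr_natr -[_ * _ / _]mulrA bin_factr//.
by ring.
Qed.

(** Binomial formula for (A + I)^N, by induction with Pascal's rule. *)
Lemma fpow_shift A (N : nat) x y :
  fpow (fun x y => A x y + (x == y)%:R) N x y =
  \sum_(k < N.+1) 'C(N, k)%:R * fpow A k x y.
Proof.
elim: N x y => [|N IH] x y; first by rewrite big_ord1 bin0 mul1r.
rewrite fpowS; under eq_bigr do rewrite mulrDr.
rewrite big_split /=.
rewrite [X in _ + X](bigD1 y)//= eqxx mulr1 [X in _ + (_ + X)]big1 ?addr0; last first.
  by move=> z /negbTE ->; rewrite mulr0.
under eq_bigr do rewrite IH mulr_suml.
rewrite exchange_big /=.
rewrite (eq_bigr (fun k : 'I_N.+1 => 'C(N, k)%:R * fpow A k.+1 x y)); last first.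
  by move=> k _; rewrite fpowS mulr_sumr; apply: eq_bigr => z _; rewrite mulrA.
rewrite IH [RHS]big_ord_recl /= bin0.
rewrite [X in _ + X]big_ord_recl /= bin0 addrCA; congr (_ + _); rewrite addrC.
under [RHS]eq_bigr do rewrite /bump /= add1n binS natrD mulrDl addrC.
rewrite [RHS]big_split /= [RHS]addrC; congr (_ + _).
rewrite [RHS]big_ord_recr /= bin_small// mul0r addr0.
by apply: eq_bigr => i _; rewrite /bump /= add1n.
Qed.

(** A generator has negative diagonal entries, so signs cannot be read off its series term by term.
    When A + I is nonnegative they can, at the price of the factor e^t, which comes out as a Cauchy
    product. *)
Lemma fexp_shift t A x y :
  fexp t (fun x y => A x y + (x == y)%:R) x y = expR t * fexp t A x y.
Proof.
have he : psum (exp_coeff t) @ \oo --> expR t.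
  by rewrite psum_series; exact: is_cvg_series_exp_coeff.
have ae : abs_summable (exp_coeff t).
  rewrite /abs_summable psum_series.
  rewrite (_ : series _ = series (exp_coeff `|t|)).
    exact: is_cvg_series_exp_coeff.
  exact: normed_series_exp_coeff.
have h := cvg_psum_cprod (@ecoef_abs_summable t A x y) ae.
rewrite mulrC (_ : expR t = limn (psum (exp_coeff t))); last first.
  by apply/esym/cvg_lim.
rewrite fexpE -(cvg_lim _ h)//; congr (limn _); apply/funext => n.
rewrite /psum; apply: eq_bigr => N _.
rewrite /cprod /ecoef fpow_shift mulr_sumr; apply: eq_bigr => k _.
have kN : (k <= N)%N by rewrite -ltnS.
have -> : t ^+ N = t ^+ k * t ^+ (N - k) by rewrite -exprD subnKC.
rewrite (_ : _ * _ = t ^+ k * t ^+ (N - k) * ('C(N, k)%:R / N`!%:R) * fpow A k x y).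
  by rewrite bin_factr// /exp_coeff /=; ring.
by ring.
Qed.

Lemma fexp_mx_ge0 t A x y : 0 <= t -> (forall x y, 0 <= A x y) ->
  0 <= fexp t A x y.
Proof.
move=> t0 A0; have fpow0 k z w : 0 <= fpow A k z w.
  elim: k w => [|k IH] w; first by rewrite fpow0 ler0n.
  by rewrite fpowS; apply: sumr_ge0 => ? _; rewrite mulr_ge0.
apply: limr_ge; first by apply/cvg_ex; eexists; exact: fexp_cvg.
by apply: nearW => n; apply: sumr_ge0 => k _; rewrite !mulr_ge0 ?invr_ge0 ?exprn_ge0.
Qed.

Lemma fexp_ge0 t A x y : 0 <= t -> (forall x y, 0 <= A x y + (x == y)%:R) ->
  0 <= fexp t A x y.
Proof.
move=> t0 A0; rewrite -(pmulr_rge0 _ (expR_gt0 t)) -fexp_shift.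
exact: fexp_mx_ge0.
Qed.

Definition fvec A (k : nat) f x : R := \sum_y fpow A k x y * f y.

Lemma fvec0 A f x : fvec A 0 f x = f x.
Proof.
rewrite /fvec (bigD1 x)//= fpow0 eqxx mul1r big1 ?addr0// => y yx.
by rewrite fpow0 eq_sym (negbTE yx) mul0r.
Qed.

(** [fpow] multiplies on the right; a factor split off on the left is what iterating a one-step
    inequality requires. *)
Lemma fvecS A k f x : fvec A k.+1 f x = \sum_y A x y * fvec A k f y.
Proof.
rewrite /fvec -add1n; under eq_bigr do rewrite fpow_add mulr_suml.
rewrite exchange_big /=; apply: eq_bigr => z _; rewrite mulr_sumr.
by apply: eq_bigr => y _; rewrite fpow1 mulrA.
Qed.

(** Through this limit, inequalities valid for every power of A + I pass to the semigroup. *)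
Lemma fexp_vec_cvg t A f x :
  psum (fun k => t ^+ k / k`!%:R * fvec (fun x y => A x y + (x == y)%:R) k f x)
    @ \oo --> expR t * \sum_y fexp t A x y * f y.
Proof.
rewrite mulr_sumr.
have h : (fun n => \sum_y psum (ecoef t (fun x y => A x y + (x == y)%:R) x y) n * f y)
     @ \oo --> \sum_y expR t * (fexp t A x y * f y).
  apply: cvg_fsum => y; rewrite mulrA -fexp_shift.
  apply: cvgM; [exact: fexp_cvg | exact: cvg_cst].
apply: cvg_trans h; apply: near_eq_cvg; apply: nearW => n /=.
rewrite /psum; under eq_bigr do rewrite mulr_suml.
rewrite exchange_big /=; apply: eq_bigr => k _.
by rewrite /fvec mulr_sumr; apply: eq_bigr => y _; rewrite /ecoef mulrA.
Qed.

(** A + I is substochastic, so its powers applied to the constant 1 stay at most 1, and the series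
    is dominated by that of e^t. *)
Lemma fexp_sum_le1 t A x : 0 <= t -> (forall x y, 0 <= A x y + (x == y)%:R) ->
  (forall x, \sum_y A x y <= 0) -> \sum_y fexp t A x y <= 1.
Proof.
move=> t0 A0 A1.
rewrite -(ler_pM2l (expR_gt0 t)) mulr1.
have := @fexp_vec_cvg t A (fun=> 1) x.
under eq_bigr do rewrite mulr1.
move=> h; have he : psum (exp_coeff t) @ \oo --> expR t.
  by rewrite psum_series; exact: is_cvg_series_exp_coeff.
apply: (ler_cvg_to h he); apply: nearW => n.
apply: ler_sum => k _; rewrite /exp_coeff ler_piMr//.
  by rewrite divr_ge0// exprn_ge0.
move: (nat_of_ord k) => {n} {}k; elim: k x {h} => [|k IH] x; first by rewrite fvec0.
rewrite fvecS; apply: (@le_trans _ _ (\sum_y (A x y + (x == y)%:R))).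
  by apply: ler_sum => y _; rewrite ler_piMr.
rewrite big_split /= (bigD1 x (F := fun y => (x == y)%:R))//= eqxx.
rewrite [X in 1 + X]big1; last by move=> y yx; rewrite eq_sym (negbTE yx).
by rewrite addr0 gerDr.
Qed.

End FinExp.

(** * One step of the path coupling *)

#[local] Opaque betaR.

(** * The Polya urn identity for beta-binomial resampling *)

Section Polya.
Variables (R : realType) (s : R).
Hypothesis s0 : 0 < s.

Lemma pascal_sum (F : nat -> nat -> R) (N : nat) :
  \sum_(k < N.+2) 'C(N.+1, k)%:R * F k (N.+1 - k)%N =
  \sum_(k < N.+1) 'C(N, k)%:R * (F k.+1 (N - k)%N + F k (N - k).+1).
Proof.
under [RHS]eq_bigr do rewrite mulrDr.
rewrite big_split /= [X in _ = _ + X]big_ord_recl [LHS]big_ord_recl /=.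
rewrite !bin0 !subn0 [RHS]addrCA; congr (_ + _).
under eq_bigr do rewrite /bump /= add1n subSS binS natrD mulrDl.
rewrite big_split /= addrC; congr (_ + _).
rewrite big_ord_recr /= bin_small// mul0r addr0; apply: eq_bigr => i _.
by rewrite /bump /= add1n subnSK.
Qed.

Lemma natrD_gt0 (k : nat) (x : R) : 0 < x -> 0 < k%:R + x.
Proof. by move=> x0; rewrite ltr_wpDl ?ler0n. Qed.

(** By Pascal's rule the terms for N + 1 pair up, and [betaR_rec] merges each pair. Unequal
    parameters are allowed because the side probabilities of the urn use s + 1 and s. *)
Lemma sum_bin_betaR (x y : R) (N : nat) : 0 < x -> 0 < y ->
  \sum_(k < N.+1) 'C(N, k)%:R * betaR (k%:R + x) ((N - k)%:R + y) = betaR x y.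
Proof.
move=> x0 y0; elim: N => [|N IH].
  by rewrite big_ord1 bin0 mul1r subnn !add0r.
rewrite (pascal_sum (fun k l => betaR (k%:R + x) (l%:R + y))) -[RHS]IH.
apply: eq_bigr => k _; congr (_ * _).
rewrite [RHS](betaR_rec (natrD_gt0 k x0) (natrD_gt0 (N - k) y0)).
by rewrite -[k.+1%:R]natr1 -[(_ - _).+1%:R]natr1 ![_ + 1 + _]addrAC.
Qed.

(* Joint law of [X] and of the side that receives the extra particle. *)
Definition polya_v (N k : nat) : R :=
  'C(N, k)%:R * betaR (k.+1%:R + s) ((N - k)%:R + s) / betaR s s.
Definition polya_w (N k : nat) : R :=
  'C(N, k)%:R * betaR (k%:R + s) ((N - k).+1%:R + s) / betaR s s.

Lemma betabin_polya (N k : nat) : betabin s N k = polya_v N k + polya_w N k.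
Proof.
rewrite /betabin /polya_v /polya_w -mulrDl -mulrDr; congr (_ * _ / _).
rewrite (betaR_rec (natrD_gt0 k s0) (natrD_gt0 (N - k) s0)).
by rewrite -[k.+1%:R]natr1 -[(_ - _).+1%:R]natr1 ![_ + 1 + _]addrAC.
Qed.

Lemma polya_v_ge0 N k : 0 <= polya_v N k.
Proof. by rewrite !mulr_ge0 ?ler0n ?invr_ge0 ?ltW ?betaR_gt0 ?natrD_gt0. Qed.

Lemma polya_w_ge0 N k : 0 <= polya_w N k.
Proof. by rewrite !mulr_ge0 ?ler0n ?invr_ge0 ?ltW ?betaR_gt0 ?natrD_gt0. Qed.

(** By symmetry the two summands of [betaR_rec] are equal. *)
Lemma betaR_half : betaR (s + 1) s / betaR s s = 1 / 2.
Proof.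
have b0 := betaR_gt0 s0 s0; have := betaR_rec s0 s0.
rewrite [betaR s (s + 1)]betaR_sym => h.
by rewrite h; have := betaR_gt0 (addr_gt0 s0 ltr01) s0 => ?; field; lra.
Qed.

Lemma sum_polya_v N : \sum_(k < N.+1) polya_v N k = 1 / 2.
Proof.
rewrite -betaR_half -(@sum_bin_betaR (s + 1) s N) ?addr_gt0// mulr_suml.
apply: eq_bigr => k _; rewrite /polya_v.
by rewrite (_ : k.+1%:R + s = k%:R + (s + 1))// -natr1 addrAC addrA.
Qed.

Lemma sum_polya_w N : \sum_(k < N.+1) polya_w N k = 1 / 2.
Proof.
rewrite -betaR_half betaR_sym -(@sum_bin_betaR s (s + 1) N) ?addr_gt0// mulr_suml.
apply: eq_bigr => k _; rewrite /polya_w.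
by rewrite (_ : (N - k).+1%:R + s = (N - k)%:R + (s + 1))// -natr1 addrAC addrA.
Qed.

(** [F] receives both counts, so that one more particle on either side is a shift of a single
    argument. *)
Definition bbsum (N : nat) (F : nat -> nat -> R) : R :=
  \sum_(k < N.+1) betabin s N k * F k (N - k)%N.

(** Expectation over N resampled particles and the side of an extra one: [F] is read if it goes to
    the first endpoint, [F'] if it goes to the second. *)
Definition polyasum (N : nat) (F F' : nat -> nat -> R) : R :=
  \sum_(k < N.+1) (polya_v N k * F k (N - k)%N + polya_w N k * F' k (N - k)%N).

Lemma bbsum_polyasum N F : bbsum N F = polyasum N F F.
Proof. by apply: eq_bigr => k _; rewrite betabin_polya mulrDl. Qed.

(** The urn identity: resampling N + 1 particles amounts to resampling N and then placing one
    more. *)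
Lemma bbsumS N F :
  bbsum N.+1 F = polyasum N (fun k l => F k.+1 l) (fun k l => F k l.+1).
Proof.
pose H k l := betaR (k%:R + s) (l%:R + s) / betaR s s * F k l.
transitivity (\sum_(k < N.+2) 'C(N.+1, k)%:R * H k (N.+1 - k)%N).
  by apply: eq_bigr => k _; rewrite /betabin /H !mulrA.
rewrite pascal_sum; apply: eq_bigr => k _.
by rewrite /H /polya_v /polya_w mulrDr !mulrA.
Qed.

#[local] Opaque polya_v polya_w.

(** Each side has total weight 1/2, whence the average of the two bounds. *)
Lemma polyasum_dist N F F' G G' (c c' : R) :
  (forall k l, `|F k l - G k l| <= c) -> (forall k l, `|F' k l - G' k l| <= c') ->
  `|polyasum N F F' - polyasum N G G'| <= (c + c') / 2.
Proof.
move=> hc hc'; rewrite -sumrB.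
apply: (@le_trans _ _ (\sum_(k < N.+1) (polya_v N k * c + polya_w N k * c'))).
  apply: le_trans (ler_norm_sum _ _ _) _; apply: ler_sum => k _.
  rewrite opprD addrACA -!mulrBr (le_trans (ler_normD _ _))//.
  rewrite [`|polya_v _ _ * _|]normrM [`|polya_w _ _ * _|]normrM.
  rewrite (ger0_norm (polya_v_ge0 _ _)) (ger0_norm (polya_w_ge0 _ _)).
  exact: lerD (ler_wpM2l (polya_v_ge0 _ _) (hc _ _))
              (ler_wpM2l (polya_w_ge0 _ _) (hc' _ _)).
rewrite big_split /= -[X in X + _]mulr_suml -[X in _ + X]mulr_suml.
rewrite sum_polya_v sum_polya_w.
by rewrite -mulrDr mulrC mulrA mulr1.
Qed.

End Polya.

(** * Updating one edge, and averaging over all edges *)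

Section Step.
Variables (R : realType) (s : R) (n : nat).
Hypothesis s0 : 0 < s.

(* Configurations with an arbitrary number of particles. *)
Definition conf := {ffun 'I_n -> nat}.
Implicit Types (z : conf) (i j u v w : 'I_n) (G : conf -> R).

Definition addp z i : conf := [ffun u => z u + (u == i)]%N.
Definition updc z v w (k l : nat) : conf :=
  [ffun u => if u == v then k else if u == w then l else z u].

Definition edge_op v w G z : R :=
  bbsum s (z v + z w) (fun k l => G (updc z v w k l)).

Lemma edge_op_out v w G z i : i != v -> i != w ->
  edge_op v w G (addp z i) =
  bbsum s (z v + z w) (fun k l => G (addp (updc z v w k l) i)).
Proof.
move=> iv iw; rewrite /edge_op.
rewrite !ffunE eq_sym (negbTE iv) eq_sym (negbTE iw) !addn0.
congr bbsum; apply/funext => k; apply/funext => l; congr G.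
apply/ffunP => u; rewrite !ffunE.
case: (eqVneq u v) => [->|uv]; first by rewrite eq_sym (negbTE iv) addn0.
by case: (eqVneq u w) => [->|uw]//; rewrite eq_sym (negbTE iw) addn0.
Qed.

(** The right-hand side does not involve [i]: an extra particle at either endpoint leads to the same
    law. This is the merging in the coupling. *)
Lemma edge_op_in v w G z i : v != w -> (i == v) || (i == w) ->
  edge_op v w G (addp z i) =
  polyasum s (z v + z w) (fun k l => G (addp (updc z v w k l) v))
                         (fun k l => G (addp (updc z v w k l) w)).
Proof.
move=> vw iP; rewrite /edge_op.
have -> : (addp z i v + addp z i w = (z v + z w).+1)%N.
  rewrite !ffunE; case/orP: iP => /eqP ->.
    by rewrite eqxx eq_sym (negbTE vw) addn0 addn1 addSn.
  by rewrite eqxx (negbTE vw) addn0 addn1 addnS.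
rewrite bbsumS; congr polyasum.
  apply/funext => k; apply/funext => l; congr G; apply/ffunP => u; rewrite !ffunE.
  have [_|uv] := eqVneq u v; first by rewrite addn1.
  rewrite addn0; case: (eqVneq u w) => // uw.
  by case/orP: iP => /eqP ->; rewrite ?(negbTE uv) ?(negbTE uw) addn0.
apply/funext => k; apply/funext => l; congr G; apply/ffunP => u; rewrite !ffunE.
case: (eqVneq u v) => [->|uv]; first by rewrite (negbTE vw) addn0.
have [_|uw] := eqVneq u w; first by rewrite addn1.
rewrite addn0.
by case/orP: iP => /eqP ->; rewrite ?(negbTE uv) ?(negbTE uw) addn0.
Qed.

Variable h : 'I_n * 'I_n -> R.
Hypothesis hd : forall i, h (i, i) = 0.

(* The expectation of [h] after the edge [{v, w}] rings and moves each of [i], [j]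
   that it contains to a uniform endpoint; if it contains both, they merge and the
   terms [h (v, v) = h (w, w) = 0] make the expression vanish. *)
Definition edge_bound v w i j : R :=
  h (i, j) + ((i == v)%:R * (h (w, j) - h (i, j)) + (i == w)%:R * (h (v, j) - h (i, j))
    + ((j == v)%:R * (h (i, w) - h (i, j)) + (j == w)%:R * (h (i, v) - h (i, j)))) / 2.

(** Four cases. With both positions on the edge, both sides are 0; with one, that particle goes to
    either endpoint with weight 1/2 while the other stays; with none, both stay. *)
Lemma edge_op_dist G v w z i j : v != w -> i != j ->
  (forall z i j, `|G (addp z i) - G (addp z j)| <= h (i, j)) ->
  `|edge_op v w G (addp z i) - edge_op v w G (addp z j)| <= edge_bound v w i j.
Proof.
move=> vw ij hG; rewrite /edge_bound.
have [iP|iN] := boolP ((i == v) || (i == w));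
  have [jP|jN] := boolP ((j == v) || (j == w)).
- rewrite !edge_op_in// subrr normr0.
  case/orP: iP jP ij => /eqP -> /orP[] /eqP ->; rewrite ?eqxx// => _.
    by rewrite [w == v]eq_sym (negbTE vw) !hd /=; lra.
  by rewrite [w == v]eq_sym (negbTE vw) !hd /=; lra.
- have /norP[jv jw] := jN; rewrite edge_op_in// edge_op_out// bbsum_polyasum//.
  apply: le_trans (polyasum_dist s0 _ (fun k l => hG _ v j) (fun k l => hG _ w j)) _.
  rewrite (negbTE jv) (negbTE jw); case/orP: iP => /eqP ->.
    by rewrite eqxx (negbTE vw) /=; lra.
  by rewrite eqxx eq_sym (negbTE vw) /=; lra.
- have /norP[iv iw] := iN; rewrite (edge_op_in _ _ vw jP) edge_op_out// bbsum_polyasum//.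
  apply: le_trans (polyasum_dist s0 _ (fun k l => hG _ i v) (fun k l => hG _ i w)) _.
  rewrite (negbTE iv) (negbTE iw); case/orP: jP => /eqP ->.
    by rewrite eqxx (negbTE vw) /=; lra.
  by rewrite eqxx eq_sym (negbTE vw) /=; lra.
- have /norP[iv iw] := iN; have /norP[jv jw] := jN.
  rewrite !edge_op_out// !bbsum_polyasum//.
  apply: le_trans (polyasum_dist s0 _ (fun k l => hG _ i j) (fun k l => hG _ i j)) _.
  by rewrite (negbTE iv) (negbTE iw) (negbTE jv) (negbTE jw) /=; lra.
Qed.

Variable r : 'I_n -> 'I_n -> R.
Hypothesis r0 : forall v, r v v = 0.
Hypothesis rsym : forall v w, r v w = r w v.
Hypothesis rge0 : forall v w, 0 <= r v w.
Hypothesis tot0 : 0 < totw r.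

Definition conf_op G z : R :=
  \sum_(v < n) \sum_(w < n | (v < w)%N) r v w / totw r * edge_op v w G z.

(** Edges are listed once, with [v < w]; those containing [i] are regrouped by their other endpoint,
    and the loop at [i] has weight 0. *)
Lemma sum_incident (a : 'I_n -> R) i :
  \sum_(v < n) \sum_(w < n | (v < w)%N)
    r v w / totw r * ((i == v)%:R * a w + (i == w)%:R * a v) =
  \sum_w r i w / totw r * a w.
Proof.
under eq_bigr do under eq_bigr do rewrite mulrDr.
under eq_bigr do rewrite big_split /=.
rewrite big_split /= (bigD1 i)//= [X in _ + X + _]big1 ?addr0; last first.
  move=> v vi; rewrite big1// => w _.
  by rewrite eq_sym (negbTE vi) mul0r mulr0.
rewrite (exchange_big_dep predT)//= [X in _ + X](bigD1 i)//=.
rewrite [X in _ + (_ + X)]big1 ?addr0; last first.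
  move=> v vi; rewrite big1// => w _.
  by rewrite eq_sym (negbTE vi) mul0r mulr0.
rewrite [RHS](bigID (fun w : 'I_n => (i < w)%N)) /=; congr (_ + _).
  by apply: eq_bigr => w _; rewrite eqxx mul1r.
rewrite [RHS](bigD1 i) ?ltnn//= r0 mul0r mul0r add0r.
apply: eq_big => [w|w _]; first by rewrite -leqNgt andbC ltn_neqAle.
by rewrite eqxx mul1r rsym.
Qed.

Lemma sum_rw_gen (f : 'I_n -> R) i :
  \sum_x rw_gen r i x * f x = (\sum_w r i w / totw r * (f w - f i)) / 2.
Proof.
rewrite (bigD1 i)//= /rw_gen eqxx [in RHS](bigD1 i)//= subrr mulr0 add0r.
rewrite [X in _ + X](eq_bigr (fun x => r i x / (2 * totw r) * f x)); last first.
  by move=> x xi; rewrite eq_sym (negbTE xi).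
rewrite mulNr mulNr mulr_suml mulr_suml -sumrN -big_split /= mulr_suml.
by apply: eq_bigr => x _; field; rewrite gt_eqF.
Qed.

Lemma sum_totw : \sum_(v < n) \sum_(w < n | (v < w)%N) r v w / totw r = 1.
Proof.
under eq_bigr do rewrite -mulr_suml.
by rewrite -mulr_suml divff// gt_eqF.
Qed.

Lemma sum_pair_gen (f : 'I_n * 'I_n -> R) i j :
  \sum_q pair_gen r (i, j) q * f q =
  \sum_x rw_gen r i x * f (x, j) + \sum_y rw_gen r j y * f (i, y).
Proof.
rewrite (eq_bigr (fun q => pair_gen r (i, j) (q.1, q.2) * f (q.1, q.2))); last by case.
rewrite -(pair_bigA _ (fun x y => pair_gen r (i, j) (x, y) * f (x, y))) /=.
rewrite /pair_gen /=.
under eq_bigr do under eq_bigr do rewrite mulrDl.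
under eq_bigr do rewrite big_split /=.
rewrite big_split /=; congr (_ + _).
  apply: eq_bigr => x _; rewrite (bigD1 j)//= eqxx mulr1 big1 ?addr0// => y yj.
  by rewrite eq_sym (negbTE yj) mulr0 mul0r.
rewrite (bigD1 i)//= [X in _ + X]big1 ?addr0; last first.
  by move=> x xi; rewrite big1// => y _; rewrite eq_sym (negbTE xi) !mul0r.
by apply: eq_bigr => y _; rewrite eqxx mul1r.
Qed.

(** The averaged edge bound is exactly one step of I plus the killed pair generator. Killing on the
    diagonal costs nothing, since [h] vanishes there. *)
Lemma sum_killed_gen i j : i != j ->
  \sum_q (killed_gen r (i, j) q + ((i, j) == q)%:R) * h q =
  \sum_(v < n) \sum_(w < n | (v < w)%N) r v w / totw r * edge_bound v w i j.
Proof.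
move=> ij.
have -> : \sum_(v < n) \sum_(w < n | (v < w)%N) r v w / totw r * edge_bound v w i j =
    h (i, j) + ((\sum_w r i w / totw r * (h (w, j) - h (i, j))) +
                (\sum_w r j w / totw r * (h (i, w) - h (i, j)))) / 2.
  rewrite -(sum_incident (fun w => h (w, j) - h (i, j))).
  rewrite -(sum_incident (fun w => h (i, w) - h (i, j))).
  have hE : h (i, j) = (\sum_(v < n) \sum_(w < n | (v < w)%N) r v w / totw r) * h (i, j).
    by rewrite sum_totw mul1r.
  rewrite [X in _ = X + _]hE -big_split /= !mulr_suml -big_split /=.
  apply: eq_bigr => v _; rewrite -big_split /= !mulr_suml -big_split /=.
  by apply: eq_bigr => w _; rewrite /edge_bound; ring.
rewrite mulrDl.
rewrite -(sum_rw_gen (fun w => h (w, j))) -(sum_rw_gen (fun w => h (i, w))).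
under eq_bigr do rewrite mulrDl.
rewrite big_split /= addrC; congr (_ + _).
  rewrite (bigD1 (i, j))//= eqxx mul1r big1 ?addr0// => q qij.
  by rewrite eq_sym (negbTE qij) mul0r.
transitivity (\sum_q pair_gen r (i, j) q * h q).
  apply: eq_bigr => -[x y] _; rewrite /killed_gen /= ij /=.
  by case: (eqVneq x y) => [->|]//=; rewrite hd !mulr0.
exact: sum_pair_gen.
Qed.

Lemma conf_op_dist G z i j :
  (forall z i j, `|G (addp z i) - G (addp z j)| <= h (i, j)) ->
  `|conf_op G (addp z i) - conf_op G (addp z j)| <=
  \sum_q (killed_gen r (i, j) q + ((i, j) == q)%:R) * h q.
Proof.
move=> hG; have [<-|ij] := eqVneq i j.
  rewrite subrr normr0; apply: sumr_ge0 => q _.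
  (* [h] is nonnegative because it bounds an absolute value. *)
  by rewrite /killed_gen /= eqxx /= add0r mulr_ge0 ?ler0n//; case: q => x y;
    apply: le_trans (hG z x y).
rewrite sum_killed_gen// /conf_op -sumrB.
apply: le_trans (ler_norm_sum _ _ _) _; apply: ler_sum => v _.
rewrite -sumrB; apply: le_trans (ler_norm_sum _ _ _) _; apply: ler_sum => w vw.
have p0 : 0 <= r v w / totw r by rewrite divr_ge0// ltW.
rewrite -mulrBr normrM ger0_norm// ler_wpM2l//; apply: edge_op_dist => //.
by apply: contraTneq vw => ->; rewrite ltnn.
Qed.

End Step.

(** * Meeting times *)

Section Killed.
Variables (R : realType) (n : nat) (r : 'I_n -> 'I_n -> R).
Hypothesis r0 : forall v, r v v = 0.
Hypothesis rsym : forall v w, r v w = r w v.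
Hypothesis rge0 : forall v w, 0 <= r v w.
Hypothesis tot0 : 0 < totw r.
Implicit Types (i j v w : 'I_n) (p q : 'I_n * 'I_n) (t u c : R).

Lemma sum_degree_le1 i : \sum_w r i w / totw r <= 1.
Proof.
rewrite -(sum_totw tot0).
have -> : \sum_w r i w / totw r = \sum_w r i w / totw r * 1.
  by apply: eq_bigr => w _; rewrite mulr1.
rewrite -(sum_incident r0 rsym (fun=> 1)); apply: ler_sum => v _.
apply: ler_sum => w vw; rewrite ler_piMr ?divr_ge0 ?(ltW tot0)// !mulr1.
have [->|_] := eqVneq i v; last by case: (i == w); rewrite add0r.
by rewrite (_ : (v == w) = false) ?addr0//; apply: contraTF vw => /eqP ->; rewrite ltnn.
Qed.

(** One walk leaves its vertex at rate at most 1/2, so the pair has exit rate at most 1, and adding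
    the identity to its generator yields nonnegative entries. *)
Lemma rw_gen_ge v w : - ((v == w)%:R / 2) <= rw_gen r v w.
Proof.
rewrite /rw_gen; have [_|_] := eqVneq v w; last first.
  by rewrite mulr0n mul0r oppr0 divr_ge0 ?mulr_ge0 ?(ltW tot0).
rewrite mulNr lerN2 ler_pdivrMr ?mulr_gt0//.
have := sum_degree_le1 v; rewrite -mulr_suml ler_pdivrMr// mul1r (bigD1 v)//= r0 add0r.
by move=> h; lra.
Qed.

Lemma pair_gen_ge p q : - (p == q)%:R <= pair_gen r p q.
Proof.
case: p q => [p1 p2] [q1 q2]; rewrite /pair_gen /= xpair_eqE.
have := rw_gen_ge p1 q1; have := rw_gen_ge p2 q2.
by case: (p1 == q1); case: (p2 == q2) => /=; lra.
Qed.

Lemma killed_shift_ge0 p q : 0 <= killed_gen r p q + (p == q)%:R.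
Proof.
rewrite /killed_gen; case: ifP => _; last by rewrite add0r ler0n.
by have := pair_gen_ge p q; lra.
Qed.

Lemma killed_sum_le0 p : \sum_q killed_gen r p q <= 0.
Proof.
have [/eqP pd|po] := boolP (p.1 == p.2).
  by rewrite big1// => q _; rewrite /killed_gen pd eqxx.
apply: (@le_trans _ _ (\sum_q pair_gen r p q * 1)).
  apply: ler_sum => q _; rewrite mulr1 /killed_gen po /=.
  have [qd|//] := eqVneq q.1 q.2.
  have := pair_gen_ge p q; rewrite (_ : (p == q) = false) ?oppr0//.
  by apply: contraNF po => /eqP ->; rewrite qd.
case: {po} p => i j; rewrite (sum_pair_gen r (fun=> 1)).
rewrite !(sum_rw_gen tot0 (fun=> 1)).
by rewrite !big1 ?mul0r ?addr0// => w _; rewrite subrr mulr0.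
Qed.

Definition offd q : R := (q.1 != q.2)%:R.
Definition kshift p q : R := killed_gen r p q + (p == q)%:R.

Lemma meet_survE i j t :
  meet_surv r i j t = \sum_q fexp t (killed_gen r) (i, j) q * offd q.
Proof.
rewrite /meet_surv big_mkcond /=; apply: eq_bigr => q _.
by rewrite /offd; case: (q.1 != q.2); rewrite ?mulr1 ?mulr0.
Qed.

Lemma kshift_fvec_ge0 k p : 0 <= fvec kshift k offd p.
Proof.
elim: k p => [|k IH] p; first by rewrite fvec0 ler0n.
by rewrite fvecS; apply: sumr_ge0 => q _; rewrite mulr_ge0// killed_shift_ge0.
Qed.

(** Diagonal rows of the killed generator are 0, so the diagonal is absorbing, and [offd] vanishes
    on it. *)
Lemma kshift_fvec_diag k i : fvec kshift k offd (i, i) = 0.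
Proof.
elim: k => [|k IH]; first by rewrite fvec0 /offd eqxx.
rewrite fvecS (bigD1 (i, i))//= IH mulr0 add0r big1// => q qi.
by rewrite /kshift /killed_gen /= eqxx /= add0r eq_sym (negbTE qi) mul0r.
Qed.

Lemma meet_surv_cvg i j t :
  psum (fun k => t ^+ k / k`!%:R * fvec kshift k offd (i, j)) @ \oo -->
  expR t * meet_surv r i j t.
Proof. by rewrite meet_survE; exact: fexp_vec_cvg. Qed.

Lemma meet_surv_diag i t : meet_surv r i i t = 0.
Proof.
have h : expR t * meet_surv r i i t = 0.
  have := cvg_lim _ (@meet_surv_cvg i i t) => <- //.
  rewrite (_ : psum _ = fun=> 0) ?lim_cst//.
  apply/funext => N; rewrite /psum big1// => k _.
  by rewrite kshift_fvec_diag mulr0.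
by move/eqP: h; rewrite mulf_eq0 gt_eqF ?expR_gt0//= => /eqP.
Qed.

Lemma meet_surv_ge0 i j t : 0 <= t -> 0 <= meet_surv r i j t.
Proof.
move=> t0; apply: sumr_ge0 => q _; apply: fexp_ge0 => //.
exact: killed_shift_ge0.
Qed.

Lemma meet_surv_le1 i j t : 0 <= t -> meet_surv r i j t <= 1.
Proof.
move=> t0; apply: le_trans (fexp_sum_le1 (i, j) t0 killed_shift_ge0 killed_sum_le0).
rewrite [leRHS](bigID (fun q : 'I_n * 'I_n => q.1 != q.2)) /= lerDl.
by apply: sumr_ge0 => q _; apply: fexp_ge0 => //; exact: killed_shift_ge0.
Qed.

(** Markov property at time [t]: from an off-diagonal pair, survival for a further time [u] has
    probability at most [c]; diagonal pairs contribute 0. *)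
Lemma meet_surv_submult i j t u c : 0 <= t ->
  (forall i j, i != j -> meet_surv r i j u <= c) ->
  meet_surv r i j (t + u) <= c * meet_surv r i j t.
Proof.
move=> t0 hc; rewrite meet_survE.
under eq_bigr do rewrite fexpD mulr_suml.
rewrite exchange_big /= [X in _ <= _ * X]meet_survE mulr_sumr; apply: ler_sum => z _.
have -> : \sum_q fexp t (killed_gen r) (i, j) z * fexp u (killed_gen r) z q * offd q
    = fexp t (killed_gen r) (i, j) z * meet_surv r z.1 z.2 u.
  rewrite meet_survE mulr_sumr; apply: eq_bigr => q _; rewrite mulrA.
  by case: z.
rewrite mulrCA ler_wpM2l//; first by apply: fexp_ge0 => //; exact: killed_shift_ge0.
rewrite /offd; have [zd|zo] := eqVneq z.1 z.2; last by rewrite mulr1 hc.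
by rewrite zd meet_surv_diag mulr0.
Qed.

Lemma meet_surv_le i j t u : 0 <= t -> 0 <= u ->
  meet_surv r i j (t + u) <= meet_surv r i j t.
Proof.
move=> t0 u0; rewrite -[leRHS]mul1r; apply: meet_surv_submult => // v w _.
exact: meet_surv_le1.
Qed.

Lemma meet_surv_pow i j t c (k : nat) : 0 <= t ->
  (forall i j, i != j -> meet_surv r i j t <= c) -> 0 <= c ->
  meet_surv r i j (k%:R * t) <= c ^+ k.
Proof.
move=> t0 hc c0; elim: k => [|k IH].
  by rewrite mul0r expr0 meet_surv_le1.
rewrite -natr1 mulrDl mul1r exprS.
apply: le_trans (meet_surv_submult _ _ _ hc) _; first by rewrite mulr_ge0.
by rewrite ler_wpM2l.
Qed.

(** A finite sum of pointwise limits of polynomials in t. *)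
Lemma measurable_meet_surv i j (D : set R) : measurable_fun D (meet_surv r i j).
Proof.
apply: (@measurable_funS _ _ _ _ setT) => //.
have mf x y : measurable_fun setT (fun t => fexp t (killed_gen r) x y).
  apply: (@measurable_fun_cvg _ _ _ setT
    (fun N t => psum (ecoef t (killed_gen r) x y) N)) => [N|t _].
    apply: measurable_sum => k; apply: measurable_funM => //.
    by apply: measurable_funM => //; exact: exprn_measurable.
  exact: fexp_cvg.
rewrite (_ : meet_surv r i j =
  fun t => \sum_(q <- [seq q <- enum predT | q.1 != q.2]) fexp t (killed_gen r) (i, j) q).
  by apply: measurable_sum => q; exact: mf.
by apply/funext => t; rewrite /meet_surv big_filter big_enum_cond.
Qed.

(** Markov's inequality: survival is nonincreasing, so on [0, t] the integrand is at least its value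
    at t. *)
Lemma exp_meet_ge i j t : 0 < t ->
  ((t * meet_surv r i j t)%:E <= exp_meet r i j)%E.
Proof.
move=> t0; rewrite /exp_meet.
have mS (D : set R) : measurable_fun D (fun t => (meet_surv r i j t)%:E).
  by apply/measurable_EFinP; exact: measurable_meet_surv.
apply: (@le_trans _ _ (\int[lebesgue_measure]_(u in `[0%R, t]) (meet_surv r i j u)%:E)%E).
  have -> : (t * meet_surv r i j t)%:E =
      (\int[lebesgue_measure]_(u in `[0%R, t]) (cst (meet_surv r i j t)%:E) u)%E.
    rewrite integral_cst//= [X in (_ * X)%E]lebesgue_measure_itv /= lte_fin t0.
    by rewrite sube0 -EFinM mulrC.
  apply: ge0_le_integral => //=.
  - by move=> u _; rewrite lee_fin meet_surv_ge0// ltW.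
  - exact: mS.
  - move=> u; rewrite in_itv /= => /andP[u0 ut]; rewrite lee_fin.
    by rewrite -(subrKC u t) meet_surv_le// subr_ge0.
apply: ge0_subset_integral => //=.
- exact: mS.
- by move=> u; rewrite in_itv /= andbT => u0; rewrite lee_fin meet_surv_ge0.
- by move=> u; rewrite /= !in_itv /= andbT => /andP[].
Qed.

End Killed.

(** * Mixing *)

Section Path.
Variables (R : realType) (n : nat).
Implicit Types (z : conf n) (F : conf n -> R).

Lemma conf_addp z (m : nat) : (\sum_u z u)%N = m.+1 ->
  exists z' i, z = addp z' i /\ (\sum_u z' u)%N = m.
Proof.
move=> zm; have [i zi] : exists i, (0 < z i)%N.
  apply/existsP; apply: contraPT zm; rewrite negb_exists => /forallP h.
  rewrite big1 => [//|u _]; by apply/eqP; have := h u; rewrite -eqn0Ngt.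
pose z' : conf n := [ffun u => z u - (u == i)]%N.
have zE : z = addp z' i.
  apply/ffunP => u; rewrite !ffunE subnK//.
  by have [->|] := eqVneq u i.
exists z', i; split => //; move: zm; rewrite zE.
under eq_bigr do rewrite ffunE.
rewrite big_split /= [X in (_ + X)%N](bigD1 i)//= eqxx [X in (1 + X)%N]big1 => [|u /negbTE ->//].
by rewrite addn0 addn1 => -[].
Qed.

Lemma conf_path F (c : R) (m : nat) z1 z2 :
  (forall z i j, `|F (addp z i) - F (addp z j)| <= c) ->
  (\sum_u z1 u)%N = m -> (\sum_u z2 u)%N = m -> `|F z1 - F z2| <= m%:R * c.
Proof.
elim: m F z1 z2 => [|m IH] F z1 z2 hF h1 h2.
  have eq0 z : (\sum_u z u)%N = 0%N -> z = [ffun=> 0%N].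
    move/eqP; rewrite sum_nat_eq0 => /forallP h; apply/ffunP => u.
    by rewrite ffunE; apply/eqP; exact: h.
  by rewrite (eq0 _ h1) (eq0 _ h2) subrr normr0 mul0r.
have [y1 [i [-> s1]]] := conf_addp h1; have [y2 [j [-> s2]]] := conf_addp h2.
rewrite -(subrKA (F (addp y1 j))) -natr1 mulrDl mul1r addrC.
apply: le_trans (ler_normD _ _) _; apply: lerD (hF _ _ _).
(* Once the first particle is moved from [i] to [j], both configurations have a particle at [j]; it
   is absorbed into the test function. *)
apply: (IH (fun z => F (addp z j))) => // z k l.
have comm a b : addp (addp z a) b = addp (addp z b) a.
  by apply/ffunP => u; rewrite !ffunE addnAC.
by rewrite ![addp (addp z _) j]comm.
Qed.

End Path.

(** * From configurations of any size to the process with m particles *)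

Section Link.
Variables (R : realType) (s : R) (n m : nat) (r : 'I_n -> 'I_n -> R).
Hypothesis s0 : 0 < s.
Hypothesis r0 : forall v, r v v = 0.
Hypothesis rsym : forall v w, r v w = r w v.
Hypothesis rge0 : forall v w, 0 <= r v w.
Hypothesis tot0 : 0 < totw r.
Implicit Types (xi eta : Omega n m) (z : conf n) (f g : Omega n m -> R).
Implicit Types (i j v w : 'I_n) (t c : R).

Definition occf xi : conf n := [ffun u => occ xi u].
(* Zero on configurations that do not have [m] particles. *)
Definition ext g z : R := \sum_eta (occf eta == z)%:R * g eta.

Lemma occf_inj : injective occf.
Proof.
move=> x y /ffunP h; apply/val_inj/ffunP => u; apply/val_inj.
by have := h u; rewrite !ffunE.
Qed.

Lemma ext_occf g xi : ext g (occf xi) = g xi.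
Proof.
rewrite /ext (bigD1 xi)//= eqxx mul1r big1 ?addr0// => eta ne.
by rewrite (inj_eq occf_inj) (negbTE ne) mul0r.
Qed.

Lemma sum_occf xi : (\sum_u occf xi u)%N = m.
Proof.
rewrite (eq_bigr (fun u => occ xi u)); last by move=> u _; rewrite ffunE.
by apply/eqP; exact: (valP xi).
Qed.

Lemma occf_surj z : (\sum_u z u)%N = m -> exists xi, occf xi = z.
Proof.
move=> zm; have zle u : (z u < m.+1)%N by rewrite ltnS -zm (bigD1 u)//= leq_addr.
pose x : {ffun 'I_n -> 'I_m.+1} := [ffun u => inord (z u)].
have xm : \sum_(i < n) (x i : nat) == m.
  by apply/eqP; rewrite -[RHS]zm; apply: eq_bigr => u _; rewrite ffunE inordK.
by exists (exist _ x xm); apply/ffunP => u; rewrite ffunE /occ /= ffunE inordK.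
Qed.

Lemma sum_updc z v w (k l : nat) : v != w -> (k + l = z v + z w)%N ->
  (\sum_u updc z v w k l u = \sum_u z u)%N.
Proof.
move=> vw kl; rewrite (bigD1 v)//= (bigD1 w) ?[w == v]eq_sym//=.
rewrite [RHS](bigD1 v)//= [in RHS](bigD1 w) ?[w == v]eq_sym//= !addnA.
rewrite !ffunE eqxx [w == v]eq_sym (negbTE vw) eqxx kl; congr (_ + _)%N.
by apply: eq_bigr => u /andP[uv uw]; rewrite ffunE (negbTE uv) (negbTE uw).
Qed.

Lemma Pedge_ext v w g xi : v != w ->
  \sum_eta Pedge s v w xi eta * g eta = edge_op s v w (ext g) (occf xi).
Proof.
move=> vw; rewrite /Pedge /edge_op /bbsum !ffunE.
under eq_bigr do rewrite mulr_suml.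
rewrite exchange_big /=; apply: eq_bigr => k _.
rewrite /ext mulr_sumr; apply: eq_bigr => eta _; rewrite -mulrA.
congr (_ * (_ * _)); congr (nat_of_bool _)%:R.
apply/idP/eqP => [/andP[/andP[/forallP h /eqP hv] /eqP hw]|/ffunP h].
  apply/ffunP => u; rewrite !ffunE.
  have [->|uv] := eqVneq u v; first by [].
  have [->|uw] := eqVneq u w; first by [].
  by have := h u; rewrite uv uw /= => /eqP.
apply/andP; split; first (apply/andP; split).
- apply/forallP => u; apply/implyP => /andP[uv uw].
  by have := h u; rewrite !ffunE (negbTE uv) (negbTE uw) => ->.
- by have := h v; rewrite !ffunE eqxx => ->.
- by have := h w; rewrite !ffunE eqxx [w == v]eq_sym (negbTE vw) => ->.
Qed.

Definition bshift xi eta : R := BBgen s r xi eta + (xi == eta)%:R.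

Lemma bshift_ext g xi : \sum_eta bshift xi eta * g eta = conf_op s r (ext g) (occf xi).
Proof.
under eq_bigr do rewrite mulrDl.
rewrite big_split /= [X in _ + X](bigD1 xi)//= eqxx mul1r.
rewrite [X in _ + (_ + X)]big1 ?addr0; last first.
  by move=> eta ne; rewrite eq_sym (negbTE ne) mul0r.
have gE : g xi = \sum_(v < n) \sum_(w < n | (v < w)%N) r v w / totw r * g xi.
  rewrite -[LHS]mul1r -(sum_totw tot0) mulr_suml.
  by apply: eq_bigr => v _; rewrite mulr_suml.
rewrite {}[X in _ + X]gE /BBgen /conf_op.
under eq_bigr do rewrite mulr_suml.
rewrite exchange_big /= -big_split /=; apply: eq_bigr => v _.
under eq_bigr do rewrite mulr_suml.
rewrite exchange_big /= -big_split /=; apply: eq_bigr => w vw.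
have vNw : v != w by apply: contraTneq vw => ->; rewrite ltnn.
rewrite -Pedge_ext// mulr_sumr.
under eq_bigr do rewrite -mulrA mulrBl mulrBr.
rewrite sumrB [X in _ - X + _](bigD1 xi)//= eqxx mul1r.
rewrite [X in _ - (_ + X) + _]big1 ?addr0 ?subrK//.
by move=> eta ne; rewrite eq_sym (negbTE ne) mul0r mulr0.
Qed.

(** Every update preserves the number of particles, so from m particles the zero values of the
    extension are never reached. *)
Lemma fvec_iter f (k : nat) xi :
  fvec bshift k f xi = iter k (conf_op s r) (ext f) (occf xi).
Proof.
elim: k xi => [|k IH] xi; first by rewrite fvec0 /= ext_occf.
rewrite fvecS bshift_ext /= /conf_op; apply: eq_bigr => v _; apply: eq_bigr => w vw.
have vNw : v != w by apply: contraTneq vw => ->; rewrite ltnn.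
congr (_ * _); rewrite /edge_op /bbsum; apply: eq_bigr => l _; congr (_ * _).
have [eta <-] : exists eta, occf eta =
    updc (occf xi) v w l (occf xi v + occf xi w - l).
  apply: occf_surj; rewrite sum_updc ?sum_occf// subnKC// -ltnS//.
by rewrite ext_occf IH.
Qed.

Lemma ext_01 f z : (forall eta, 0 <= f eta <= 1) -> 0 <= ext f z <= 1.
Proof.
move=> f01; have [[xi <-]|nz] := pselect (exists xi, occf xi = z).
  by rewrite ext_occf.
rewrite /ext big1 ?lexx ?ler01// => eta _.
by rewrite (_ : (_ == _) = false) ?mul0r//; apply/negbTE/eqP => h; apply: nz; exists eta.
Qed.

(** Iterates [conf_op_dist], with [h] the bound for the previous power; it vanishes on the diagonal,
    as required. *)
Lemma iter_dist f (k : nat) z i j : (forall eta, 0 <= f eta <= 1) ->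
  `|iter k (conf_op s r) (ext f) (addp z i) - iter k (conf_op s r) (ext f) (addp z j)|
  <= fvec (kshift r) k (@offd R n) (i, j).
Proof.
move=> f01; elim: k z i j => [|k IH] z i j.
  rewrite fvec0 /offd /=; have [->|ij] := eqVneq i j; first by rewrite subrr normr0.
  have /andP[a0 a1] := ext_01 (addp z i) f01.
  have /andP[b0 b1] := ext_01 (addp z j) f01.
  by rewrite ler_norml /=; apply/andP; split; lra.
rewrite fvecS; apply: (@conf_op_dist _ _ _ s0 (fvec (kshift r) k (@offd R n))) => //.
exact: kshift_fvec_diag.
Qed.

Lemma semigroup_dist f t c xi eta : 0 <= t -> 0 <= c ->
  (forall i j, i != j -> meet_surv r i j t <= c) ->
  (forall eta, 0 <= f eta <= 1) ->
  `|\sum_y fexp t (BBgen s r) xi y * f y - \sum_y fexp t (BBgen s r) eta y * f y|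
  <= m%:R * c.
Proof.
move=> t0 c0 hc f01.
(* Truncated series defined on all configurations. The one-particle bound holds for every [N], as
   partial sums of a nonnegative series stay below its limit; [N] goes to infinity only at the
   end. *)
pose F (N : nat) z : R :=
  psum (fun k => t ^+ k / k`!%:R * iter k (conf_op s r) (ext f) z) N.
have Fcvg x : F^~ (occf x) @ \oo --> expR t * \sum_y fexp t (BBgen s r) x y * f y.
  have := @fexp_vec_cvg R (Omega n m) t (BBgen s r) f x; apply: cvg_trans.
  apply: near_eq_cvg; apply: nearW => N; apply: eq_bigr => k _.
  by rewrite -fvec_iter.
have coef0 k : 0 <= t ^+ k / k`!%:R by rewrite divr_ge0// exprn_ge0.
have FL N z i j : `|F N (addp z i) - F N (addp z j)| <= expR t * c.
  apply: (@le_trans _ _ (expR t * meet_surv r i j t)); last first.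
    rewrite ler_pM2l ?expR_gt0//; have [->|ij] := eqVneq i j; last exact: hc.
    by rewrite meet_surv_diag.
  apply: (@le_trans _ _
      (psum (fun k => t ^+ k / k`!%:R * fvec (kshift r) k (@offd R n) (i, j)) N)).
    rewrite /F /psum -sumrB; apply: le_trans (ler_norm_sum _ _ _) _.
    apply: ler_sum => k _; rewrite -mulrBr normrM ger0_norm//.
    by rewrite ler_wpM2l// iter_dist.
  have h := @meet_surv_cvg R n r i j t.
  rewrite -(cvg_lim _ h)//; apply: nondecreasing_cvgn_le; last first.
    by apply/cvg_ex; eexists; exact: h.
  apply/nondecreasing_seqP => k; rewrite psumS lerDl mulr_ge0//.
  exact: kshift_fvec_ge0.
rewrite -(ler_pM2l (expR_gt0 t)) -[X in X * `|_|]ger0_norm ?expR_ge0//.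
rewrite -normrM mulrBr mulrCA.
have h : (fun N => `|F N (occf xi) - F N (occf eta)|) @ \oo -->
    `|expR t * \sum_y fexp t (BBgen s r) xi y * f y -
      expR t * \sum_y fexp t (BBgen s r) eta y * f y|.
  by apply: cvg_norm; apply: cvgB; exact: Fcvg.
apply: (ler_cvg_to h (cvg_cst _)); apply: nearW => N.
by apply: conf_path (FL N) _ _; exact: sum_occf.
Qed.

Lemma tv_equilibrium_le (pi : Omega n m -> R) t c xi :
  equilibrium (BBgen s r) pi -> 0 <= t -> 0 <= c ->
  (forall i j, i != j -> meet_surv r i j t <= c) ->
  tv (fexp t (BBgen s r) xi) pi <= m%:R * c.
Proof.
move=> [pi0 [pi1 piE]] t0 c0 hc.
set mu := fexp t (BBgen s r) xi.
(* The indicator of the set attaining the total variation; stationarity turns its [pi]-mass into an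
   average over starting points. *)
pose f y : R := (pi y < mu y)%R%:R.
have f01 y : 0 <= f y <= 1 by rewrite /f; case: (_ < _); rewrite /= ?lexx ?ler01.
have -> : tv mu pi = \sum_x pi x *
    (\sum_y mu y * f y - \sum_y fexp t (BBgen s r) x y * f y).
  under [RHS]eq_bigr do rewrite mulrBr.
  rewrite sumrB -mulr_suml pi1 mul1r.
  under [X in _ = _ - X]eq_bigr do rewrite mulr_sumr.
  rewrite exchange_big /= -sumrB; apply: eq_bigr => y _.
  under eq_bigr do rewrite mulrA.
  rewrite -mulr_suml piE// -mulrBl /f.
  case: ltP => h; first by rewrite mulr1 max_l// subr_ge0 ltW.
  by rewrite mulr0 max_r// subr_le0.
apply: (@le_trans _ _ (\sum_x pi x * (m%:R * c))).
  apply: ler_sum => x _; rewrite ler_wpM2l//.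
  exact: le_trans (ler_norm _) (semigroup_dist _ _ t0 c0 hc f01).
by rewrite -mulr_suml pi1 mul1r.
Qed.

End Link.

(** * The mixing time bound and its constants *)

Section Main.
Variable R : realType.

(** From e^(-1/2) >= 1 - 1/2. *)
Lemma ln2_ge_half : 1 / 2 <= ln 2 :> R.
Proof.
rewrite -ler_expR lnK ?posrE//.
have := expR_ge1Dx (- (1 / 2) : R); rewrite expRN => h.
have e0 := expR_gt0 (1 / 2 : R).
rewrite -(ler_pM2r (_ : 0 < (expR (1 / 2))^-1 :> R)) ?invr_gt0//.
by rewrite mulfV ?gt_eqF//; lra.
Qed.

(** The first step of a path from vertex 0 to vertex 1 is an edge of positive weight. *)
Lemma totw_gt0 (n : nat) (r : 'I_n -> 'I_n -> R) :
  (1 < n)%N -> connected_wgraph r -> 0 < totw r.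
Proof.
move=> n1 [r0 [rsym [rge0 conn]]].
pose a : 'I_n := Ordinal (ltn_trans (ltnSn 0) n1); pose b : 'I_n := Ordinal n1.
have /connectP[[|x p]] := conn a b; first by move=> _ /(congr1 val).
rewrite /= => /andP[ax _] _.
have inner (v : 'I_n) : 0 <= \sum_(w < n | (v < w)%N) r v w by apply: sumr_ge0.
rewrite /totw (bigD1 a)//= ltr_pwDl//; last exact: sumr_ge0.
rewrite (bigD1 x)//=; last first.
  by rewrite lt0n; apply: contraTneq ax => x0; rewrite (_ : x = a) ?r0 ?ltxx//; apply/val_inj.
by rewrite ltr_pwDl//; exact: sumr_ge0.
Qed.

Lemma exp_meet_le_max (n : nat) (r : 'I_n -> 'I_n -> R) (i j : 'I_n) :
  i != j -> (exp_meet r i j <= max_meet r)%E.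
Proof.
move=> ij; rewrite /max_meet.
apply: (@le_trans _ _ (\big[Order.max/0%E]_(j < n | i != j) exp_meet r i j)).
  exact: le_bigmax_cond.
exact: (le_bigmax _ (fun i => \big[Order.max/0%E]_(j < n | i != j) exp_meet r i j)).
Qed.

Lemma max_meet_ge0 (n : nat) (r : 'I_n -> 'I_n -> R) : (0 <= max_meet r)%E.
Proof. exact: bigmax_ge_id. Qed.

Lemma mixing_bound6 (s : R) : 0 < s -> mixing_bound s 6.
Proof.
move=> s0 n r m n1 G m2 pi eqpi eps /andP[e0 e4].
have tot0 := totw_gt0 n1 G; have [r0 [rsym [rge0 _]]] := G.
set L := ln _.
have e0' := ltW e0.
have nm4 : 4 <= (n + m)%:R :> R by rewrite ler_nat (leq_add n1 m2).
have nm0 : 0 < (n + m)%:R / eps by rewrite divr_gt0//; lra.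
(* (n + m) / eps is at least 16, as n + m >= 4 and eps < 1/4. *)
have L1 : 1 <= L.
  apply: (@le_trans _ _ (ln (2 ^+ 4 : R))).
    have -> : ln (2 ^+ 4 : R) = 4 * ln 2 by rewrite lnXn// mulr_natl.
    by have := ln2_ge_half; lra.
  by rewrite ler_ln ?posrE// ler_pdivlMr//; lra.
have := max_meet_ge0 r; have := @exp_meet_le_max n r.
(* For an infinite maximal meeting time the bound is trivial, its coefficient being positive. *)
case: (max_meet r) => [tau hmax tau0|_ _|//]; last first.
  by rewrite gt0_muley ?leey// lte_fin; lra.
rewrite lee_fin in tau0.
(* The slack [d] keeps the time [t0] below positive without any lower bound on [tau] beyond 0. *)
suff key (d : R) : 0 < d -> (tmix (BBgen s r) pi eps <= (6 * L * tau + d)%:E)%E.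
  by rewrite -EFinM; apply/lee_addgt0Pr => d d0; rewrite -EFinD; exact: key.
move=> d0.
(* k >= 2L gives 2^k >= e^L because ln 2 >= 1/2, and k <= 2L + 1 <= 3L because L >= 1. The factor 6
   is 3L times the 2 [tau] of [t0], divided by L [tau]. *)
pose k := (Num.truncn (2 * L)).+1.
have kL : k%:R <= 3 * L.
  have L0 : 0 <= 2 * L by lra.
  by have := truncn_le (2 * L); rewrite L0 /k -natr1; lra.
have k2 : 2 * L <= k%:R.
  by apply: ltW; rewrite /k; exact: truncnS_gt.
pose t0 := 2 * tau + d / (3 * L).
have dL : 0 < d / (3 * L) by rewrite divr_gt0//; lra.
have t00 : 0 < t0 by rewrite /t0; lra.
have half i j : i != j -> meet_surv r i j t0 <= 1 / 2.
  move=> ij; have := le_trans (exp_meet_ge r0 rsym rge0 tot0 i j t00) (hmax i j ij).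
  rewrite lee_fin => h.
  by rewrite -(ler_pM2l t00) (le_trans h)// /t0; lra.
have t0' := ltW t00.
apply: (@le_trans _ _ (k%:R * t0)%:E).
  apply: ereal_inf_lbound; exists (k%:R * t0) => //=; split.
    by rewrite mulr_ge0.
  apply: bigmax_le => // xi _.
  have c0 : 0 <= (1 / 2 : R) ^+ k by rewrite exprn_ge0//; lra.
  have hc i j : i != j -> meet_surv r i j (k%:R * t0) <= (1 / 2) ^+ k.
    by move=> _; apply: meet_surv_pow => //; lra.
  have kt0 : 0 <= k%:R * t0 by rewrite mulr_ge0.
  apply: le_trans (tv_equilibrium_le s0 r0 rsym rge0 tot0 xi eqpi kt0 c0 hc) _.
  rewrite div1r exprVn ler_pdivrMr ?exprn_gt0//.
  rewrite mulrC -ler_pdivrMr//.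
  apply: (@le_trans _ _ ((n + m)%:R / eps)).
    by rewrite ler_pM2r ?invr_gt0// ler_nat leq_addl.
  rewrite -ler_ln ?posrE ?exprn_gt0// lnXn// -[ln 2 *+ k]mulr_natl.
  apply: (@le_trans _ _ (k%:R * (1 / 2))); first by rewrite -/L; lra.
  by rewrite ler_wpM2l// ln2_ge_half.
rewrite lee_fin (@le_trans _ _ (3 * L * t0))// ?ler_wpM2r//.
have L0 : L != 0 by rewrite gt_eqF//; lra.
rewrite /t0 (_ : 3 * L * _ = 6 * L * tau + d)//.
by field.
Qed.

Lemma mixing_boundW (s C C' : R) : C <= C' -> mixing_bound s C -> mixing_bound s C'.
Proof.
move=> CC h n r m n1 G m2 pi eqpi eps e; apply: le_trans (h _ _ _ n1 G m2 _ eqpi _ e) _.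
apply: lee_wpmul2r; first exact: max_meet_ge0.
rewrite lee_fin ler_wpM2r// ln_ge0//.
move/andP: e => [e0 e4].
have : 1 <= (n + m)%:R :> R by rewrite ler1n addn_gt0 (ltnW n1).
by rewrite ler_pdivlMr//; lra.
Qed.

End Main.

Theorem theorem1 (R : realType) :
  (forall a b : nat, (0 < a)%N -> (0 < b)%N ->
     exists C : R, 0 < C /\ mixing_bound (b%:R / a%:R) C)
  /\
  (exists C' : R, 0 < C' /\
     forall a b : nat, (0 < a)%N -> (0 < b)%N -> coprime a b ->
       let s : R := b%:R / a%:R in
       let p := pstar s in
       mixing_bound s
         (C' * a%:R * p ^-2 * ln (12 * a%:R * p ^-2) * ln ((a + b)%:R))).
Proof.
split=> [a b a0 b0|].
  by exists 6; split=> //; apply: mixing_bound6; rewrite divr_gt0 ?ltr0n.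
(* 24 = 6 * 4: each logarithm is at least ln 2 >= 1/2, so their product is at least 1/4, and
   [a%:R * p ^- 2] is at least 1. *)
exists 24; split=> // a b a0 b0 _ s p.
have s0 : 0 < s by rewrite divr_gt0 ?ltr0n.
apply: mixing_boundW (mixing_bound6 s0).
have /andP[p0 p1] := pstar_gt0_le1 s0.
have q1 : 1 <= p ^- 2 by rewrite invf_ge1 ?exprn_gt0// exprn_ile1// ltW.
have a1 : 1 <= a%:R :> R by rewrite ler1n.
have aq : 1 <= a%:R * p ^- 2 by rewrite mulr_ege1.
have l1 : 1 / 2 <= ln (12 * a%:R * p ^- 2).
  apply: le_trans (ln2_ge_half R) _.
  by rewrite ler_ln ?posrE// -mulrA; lra.
have l2 : 1 / 2 <= ln ((a + b)%:R : R).
  apply: le_trans (ln2_ge_half R) _.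
  by rewrite ler_ln ?posrE ?ltr0n ?addn_gt0 ?a0// ler_nat -(addn1 1) leq_add.
set x := a%:R * _ in aq; set l := ln _ in l1; set l' := ln _ in l2.
have -> : 24 * a%:R * p ^- 2 * l * l' = 24 * (x * (l * l')) by rewrite /x; ring.
have ll : 1 / 4 <= l * l' by nra.
by nra.
Qed.
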